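(* Let $G=(V,E)$, the weights, $F$ and $k$ be as in the model. For each vertex $v\in V$, let $d_v=d(v,F)$ and fix a point $f(v)\in F$ with $d(v,f(v))=d_v$. Let $$\Gamma(v)=\{p\in G: p\neq f(v),\ d(v,p)=d_v\},\qquad \Gamma_0=\bigcup_{v\in V}\Gamma(v).$$ For $\varepsilon>0$, let $N_\varepsilon=\{p\in G: d(p,F)=\varepsilon\}$ (the points at distance exactly $\varepsilon$ from P1's facilities), and let $C_\varepsilon=(\Gamma_0\cup V\cup N_\varepsilon)\setminus F$. Then $$\eta(F)=\sup_{\varepsilon>0}\ \max\{\mathcal Q_2(F,S): S\subseteq C_\varepsilon,\ |S|\le k\}.$$ That is, placements of P2 using only points of $\Gamma_0\cup V$ together with points arbitrarily close to P1's facilities achieve the optimal payoff of P2.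
   Context: Model. $G=(V,E)$ is a finite connected graph with at least one edge. Each vertex $v$ has a weight $w(v)\ge 0$ and each edge $e$ has a length $w(e)>0$. $G$ is regarded as a metric space by identifying each edge $e=(u,v)$ with a segment of length $w(e)$ joining $u$ and $v$. A point of $G$ is a vertex or a point of an edge. $d(p,q)$ denotes the length of a shortest path in $G$ between points $p$ and $q$. For a finite nonempty set $A$ of points, $d(p,A)=\min_{a\in A}d(p,a)$. Player P1 places a set $F$ of $m\ge 1$ points of $G$. Afterwards Player P2 places a set $S$ of $k$ points of $G$ with $S\cap F=\emptyset$. A point $p$ is served by P2 if $d(p,S)\le d(p,F)$ (ties go to P2), and by P1 otherwise. The payoff of P2 is $$\mathcal Q_2(F,S)=\sum_{v\in V:\ d(v,S)\le d(v,F)} w(v)\;+\;\lambda\big(\{p \text{ in the interior of an edge}: d(p,S)\le d(p,F)\}\big),$$ where $\lambda$ is total length (one-dimensional Lebesgue measure along the edges). The payoff $\mathcal Q_2(F,S)$ is defined by the same formula for any finite set $S$ disjoint from $F$. The maximum payoff of P2 is $\eta(F)=\sup_S \mathcal Q_2(F,S)$, where the supremum ranges over all sets $S$ of $k$ points of $G$ disjoint from $F$. In the paper, the points of $N_\varepsilon$ for infinitesimal $\varepsilon$ are modelled as ''points at distance effectively zero from a facility of P1''. *)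

(* Defs.v *)
From Stdlib Require Import Reals Lra List Classical ClassicalEpsilon.
Import ListNotations.
Open Scope R_scope.

(* A weighted graph: vertices are 0..n-1, edges is a list of (u, v, length). *)
Definition edge := (nat * nat * R)%type.
Definition e_src (e : edge) : nat := fst (fst e).
Definition e_dst (e : edge) : nat := snd (fst e).
Definition e_len (e : edge) : R := snd e.
Definition nth_edge (E : list edge) (i : nat) : edge := nth i E (0%nat, 0%nat, 0).

(* Points of the metric graph: a vertex, or the interior point of edge i
   at distance t from its source endpoint (0 < t < length). *)
Inductive point := PV (v : nat) | PE (i : nat) (t : R).

Definition valid_point (n : nat) (E : list edge) (p : point) : Prop :=
  match p with
  | PV v => (v < n)%nat
  | PE i t => (i < length E)%nat /\ 0 < t < e_len (nth_edge E i)
  end.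

Fixpoint walk (E : list edge) (u v : nat) (l : list nat) : Prop :=
  match l with
  | [] => u = v
  | i :: l' => (i < length E)%nat /\
      ((e_src (nth_edge E i) = u /\ walk E (e_dst (nth_edge E i)) v l') \/
       (e_dst (nth_edge E i) = u /\ walk E (e_src (nth_edge E i)) v l'))
  end.

Fixpoint walk_len (E : list edge) (l : list nat) : R :=
  match l with
  | [] => 0
  | i :: l' => e_len (nth_edge E i) + walk_len E l'
  end.

Definition access (E : list edge) (p : point) : list (nat * R) :=
  match p with
  | PV v => [(v, 0)]
  | PE i t => [(e_src (nth_edge E i), t); (e_dst (nth_edge E i), e_len (nth_edge E i) - t)]
  end.

Definition path_len (E : list edge) (p q : point) (r : R) : Prop :=
  (exists i t s, p = PE i t /\ q = PE i s /\ r = Rabs (t - s)) \/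
  (exists a c1 b c2 l, In (a, c1) (access E p) /\ In (b, c2) (access E q) /\
     walk E a b l /\ r = c1 + walk_len E l + c2).

Definition gdist (E : list edge) (p q : point) : R :=
  epsilon (inhabits 0)
    (fun r => path_len E p q r /\ forall r', path_len E p q r' -> r <= r').

Definition dist_set (E : list edge) (p : point) (A : list point) : R :=
  match A with
  | [] => 0
  | a :: A' => fold_right (fun q acc => Rmin (gdist E p q) acc) (gdist E p a) A'
  end.

Definition served (E : list edge) (F S : list point) (p : point) : Prop :=
  exists s, In s S /\ gdist E p s <= dist_set E p F.

Definition ind (P : Prop) (x : R) : R :=
  if excluded_middle_informative P then x else 0.

(* Riemann integral of f over [a,b] (well defined when integrable). *)
Definition integral (f : R -> R) (a b : R) : R :=
  epsilon (inhabits 0)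
    (fun r => exists pr : Riemann_integrable f a b, RiemannInt pr = r).

Definition served_len (E : list edge) (F S : list point) (i : nat) : R :=
  integral (fun t => ind (served E F S (PE i t)) 1) 0 (e_len (nth_edge E i)).

Definition sumR (l : list R) : R := fold_right Rplus 0 l.

Definition Q2 (n : nat) (E : list edge) (wv : nat -> R) (F S : list point) : R :=
  sumR (map (fun v => ind (served E F S (PV v)) (wv v)) (seq 0 n)) +
  sumR (map (served_len E F S) (seq 0 (length E))).

Definition good_graph (n : nat) (E : list edge) (wv : nat -> R) : Prop :=
  E <> [] /\
  (forall e, In e E -> (e_src e < n)%nat /\ (e_dst e < n)%nat /\
                       e_src e <> e_dst e /\ 0 < e_len e) /\
  (forall i j, (i < length E)%nat -> (j < length E)%nat -> i <> j ->
     ~ ((e_src (nth_edge E i) = e_src (nth_edge E j) /\ e_dst (nth_edge E i) = e_dst (nth_edge E j)) \/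
        (e_src (nth_edge E i) = e_dst (nth_edge E j) /\ e_dst (nth_edge E i) = e_src (nth_edge E j)))) /\
  (forall u v, (u < n)%nat -> (v < n)%nat -> exists l, walk E u v l) /\
  (forall v, (v < n)%nat -> 0 <= wv v).

Definition point_set (n : nat) (E : list edge) (A : list point) : Prop :=
  NoDup A /\ forall p, In p A -> valid_point n E p.

(* Main.v *)
(* Fix all facilities of P2 but one, and let the remaining one, at [x0], lie on an edge strictly
   between two consecutive points [a], [b] of Gamma_0, V and F. No vertex changes its owner while
   that facility moves in [a, b], except that ties at the ends go to P2. On a segment of an edge
   between two consecutive vertices or facilities of P1, the part served by P2 is an interval, whose
   ends are midpoints between facilities of the two players. Since the distance from a vertex is a
   concave function of the position on an edge, these intervals, and hence the payoff, are bounded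
   below by affine functions of the position that are exact at [x0]. So the payoff does not decrease
   when the facility moves in one of the two directions: to [a] or [b], or, when P1 occupies that
   end, to distance eps from it. Doing this for all facilities of P2 in turn proves the theorem. *)
From Stdlib Require Import Reals List Lra Lia Classical ClassicalEpsilon.
From Coquelicot Require Import Coquelicot.
Require Import Defs.
Import ListNotations.
Open Scope R_scope.

(** As [x] moves, different facilities may delimit the part of a segment served by P2, so the payoff
    itself is awkward to describe. A minorant exact at [x0] needs less: it suffices to follow, for
    each end, the facility that delimits the part at [x0], since the others can only enlarge it.
    Such minorants add up, so segments and vertices can be treated separately, and the sign of the
    total slope gives the direction of the move. Two facilities of P2 may be moved to the same
    point. Intermediate positions are therefore lists with possible repetitions, which do not affect
    the payoff; removing them at the end may leave fewer than [k] points. One [eps] has to work for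
    all facilities of P2. The interval around a facility does not depend on the other facilities of
    P2, so each has its own threshold for [eps], and the least threshold is used. *)

(** * Finite predicates and the distance to a finite set *)

Definition finite {A} (P : A -> Prop) : Prop := exists l, forall x, P x -> In x l.

Lemma finite_sub {A} (P Q : A -> Prop) : (forall x, P x -> Q x) -> finite Q -> finite P.
Proof. intros H [l Hl]. exists l. auto. Qed.

Lemma finite_single {A} (a : A) : finite (fun x => x = a).
Proof. exists [a]. intros x ->. now left. Qed.

Lemma finite_or {A} (P Q : A -> Prop) : finite P -> finite Q -> finite (fun x => P x \/ Q x).
Proof.
  intros [l Hl] [l' Hl']. exists (l ++ l'). intros x H. apply in_or_app.
  destruct H; auto.
Qed.

Lemma finite_ex {A B} (l : list A) (P : A -> B -> Prop) :
  (forall a, In a l -> finite (P a)) -> finite (fun b => exists a, In a l /\ P a b).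
Proof.
  induction l as [|a l IH]; intros H.
  - exists []. now intros b [a [[] _]].
  - apply finite_sub with (fun b => P a b \/ exists a', In a' l /\ P a' b).
    + intros b [a' [[<-|Ha] Hb]]; [now left|right; eauto].
    + apply finite_or; [apply H; now left|apply IH; intros; apply H; now right].
Qed.

Lemma finite_lists {A} (l : list A) (k : nat) :
  finite (fun s => (length s <= k)%nat /\ incl s l).
Proof.
  induction k as [|k IH].
  - exists [[]]. intros [|x s] [H _]; simpl in *; [now left|lia].
  - apply finite_sub with (fun s => s = [] \/ exists x, In x l /\ exists s',
       In s' (proj1_sig (constructive_indefinite_description _ IH)) /\ s = x :: s').
    + intros [|x s] [H1 H2]; [now left|right]. exists x; split; [apply H2; now left|].
      exists s; split; [|easy]. destruct constructive_indefinite_description as [L HL]; simpl.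
      apply HL; split; [simpl in H1; lia|]. intros y Hy; apply H2; now right.
    + apply finite_or; [apply finite_single|]. apply finite_ex; intros x _.
      apply finite_ex; intros s _. apply finite_single.
Qed.

Lemma finite_argmax {A} (val : A -> R) (P : A -> Prop) :
  finite P -> (exists x, P x) -> exists x, P x /\ forall y, P y -> val y <= val x.
Proof.
  intros [l Hl] [x0 H0].
  assert (H : forall l, (exists x, In x l /\ P x) ->
            exists x, P x /\ forall y, In y l -> P y -> val y <= val x).
  { clear. induction l as [|a l IH]; intros [x [Hx Px]]; [easy|].
    destruct (classic (exists x, In x l /\ P x)) as [H|H].
    - destruct (IH H) as [z [Pz Hz]].
      destruct (classic (P a /\ val z <= val a)) as [[Pa Ha]|Ha].
      + exists a; split; [easy|]. intros y [<-|Hy] Py; [lra|]. specialize (Hz y Hy Py); lra.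
      + exists z; split; [easy|]. intros y [<-|Hy] Py; [|auto].
        apply Rnot_lt_le; intros Hlt. apply Ha; split; [easy|lra].
    - destruct Hx as [<-|Hx]; [|exfalso; eauto].
      exists a; split; [easy|]. intros y [<-|Hy] Py; [lra|]. exfalso; eauto. }
  destruct (H l) as [x [Px Hx]]; [eauto|]. exists x; split; auto.
Qed.

Lemma dist_set_attained (E : list edge) (p : point) (F : list point) :
  F <> [] -> exists q, In q F /\ gdist E p q = dist_set E p F.
Proof.
  destruct F as [|a F]; [easy|intros _]; simpl.
  induction F as [|b F [q [Hq Hd]]]; simpl; [exists a; auto|].
  unfold Rmin. destruct Rle_dec.
  - exists b; auto.
  - exists q; split; [|easy]. destruct Hq; auto.
Qed.

Lemma dist_set_le (E : list edge) (p q : point) (F : list point) :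
  In q F -> dist_set E p F <= gdist E p q.
Proof.
  destruct F as [|a F]; [easy|]; simpl.
  induction F as [|b F IH]; simpl; intros H.
  - destruct H as [<-|[]]. lra.
  - destruct H as [<-|[<-|H]].
    + eapply Rle_trans; [apply Rmin_r|auto].
    + apply Rmin_l.
    + eapply Rle_trans; [apply Rmin_r|auto].
Qed.

(** * Integrals of indicator functions *)

Lemma ind_true (P : Prop) (x : R) : P -> ind P x = x.
Proof. unfold ind. destruct excluded_middle_informative; easy. Qed.

Lemma ind_false (P : Prop) (x : R) : ~ P -> ind P x = 0.
Proof. unfold ind. destruct excluded_middle_informative; easy. Qed.

Lemma ind_mono (P Q : Prop) (x : R) : 0 <= x -> (P -> Q) -> ind P x <= ind Q x.
Proof. unfold ind. repeat destruct excluded_middle_informative; intros; tauto || lra. Qed.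

Lemma integral_RInt (f : R -> R) (a b : R) : ex_RInt f a b -> integral f a b = RInt f a b.
Proof.
  intros Hf. unfold integral.
  destruct (epsilon_spec (inhabits 0)
    (fun r => exists pr : Riemann_integrable f a b, RiemannInt pr = r)) as [pr Hpr].
  - exists (RiemannInt (ex_RInt_Reals_0 _ _ _ Hf)). eauto.
  - rewrite <- Hpr. symmetry. apply RInt_Reals.
Qed.

Lemma is_RInt_ind_interval (P : R -> Prop) (a p q b : R) : a <= p <= q -> q <= b ->
  (forall t, a < t < p -> ~ P t) -> (forall t, p < t < q -> P t) ->
  (forall t, q < t < b -> ~ P t) -> is_RInt (fun t => ind (P t) 1) a b (q - p).
Proof.
  intros Hp Hq H1 H2 H3.
  assert (I1 : is_RInt (fun t => ind (P t) 1) a p ((p - a) * 0)).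
  { apply is_RInt_ext with (fun _ => 0); [|apply (is_RInt_const a p 0)].
    rewrite Rmin_left, Rmax_right by lra. intros t Ht. rewrite ind_false; auto. }
  assert (I2 : is_RInt (fun t => ind (P t) 1) p q ((q - p) * 1)).
  { apply is_RInt_ext with (fun _ => 1); [|apply (is_RInt_const p q 1)].
    rewrite Rmin_left, Rmax_right by lra. intros t Ht. rewrite ind_true; auto. }
  assert (I3 : is_RInt (fun t => ind (P t) 1) q b ((b - q) * 0)).
  { apply is_RInt_ext with (fun _ => 0); [|apply (is_RInt_const q b 0)].
    rewrite Rmin_left, Rmax_right by lra. intros t Ht. rewrite ind_false; auto. }
  assert (I := is_RInt_Chasles _ _ _ _ _ _ (is_RInt_Chasles _ _ _ _ _ _ I1 I2) I3).
  replace (q - p) with (plus (plus ((p - a) * 0) ((q - p) * 1)) ((b - q) * 0)); [exact I|].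
  unfold plus; simpl. lra.
Qed.

(** A convex part of an open interval fills the space between its infimum and its supremum, and
    whether these two points belong to it does not affect the integral. *)
Lemma ex_RInt_ind_convex (P : R -> Prop) (a b : R) : a <= b ->
  (forall s t u, a < s -> s < t < u -> u < b -> P s -> P u -> P t) ->
  ex_RInt (fun t => ind (P t) 1) a b.
Proof.
  intros Hab Hc.
  destruct (classic (exists t, a < t < b /\ P t)) as [[t0 [Ht0 P0]]|Hn].
  - destruct (completeness (fun t => a < t < b /\ P t)) as [q [Hq Hq']];
      [exists b; intros t [Ht _]; lra|eauto|].
    (* [p] is the supremum of the negated set, so the infimum is [- p]. *)
    destruct (completeness (fun t => a < - t < b /\ P (- t))) as [p [Hp Hp']];
      [exists (- a); intros t [Ht _]; lra|exists (- t0); rewrite Ropp_involutive; auto|].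
    assert (t0 <= q) by (now apply Hq).
    assert (- t0 <= p) by (apply Hp; rewrite Ropp_involutive; auto).
    assert (q <= b) by (apply Hq'; intros t [Ht _]; lra).
    assert (p <= - a) by (apply Hp'; intros t [Ht _]; lra).
    exists (q - - p). apply is_RInt_ind_interval; try lra.
    + intros t Ht Pt. assert (- t <= p); [|lra].
      apply Hp. rewrite Ropp_involutive. split; [lra|easy].
    + intros t Ht.
      assert (Hs : exists s, (a < s < b /\ P s) /\ s < t).
      { apply NNPP. intros Hn. assert (p <= - t); [|lra].
        apply Hp'. intros s Hs. apply Rnot_lt_le. intros Hlt.
        apply Hn. exists (- s); split; [easy|lra]. }
      assert (Hu : exists u, (a < u < b /\ P u) /\ t < u).
      { apply NNPP. intros Hn. assert (q <= t); [|lra].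
        apply Hq'. intros u Hu. apply Rnot_lt_le. intros Hlt.
        apply Hn. exists u; split; [easy|lra]. }
      destruct Hs as [s [[Hs Ps] Hst]], Hu as [u [[Hu Pu] Htu]].
      apply (Hc s t u); auto; lra.
    + intros t Ht Pt. assert (t <= q); [|lra]. apply Hq. split; [lra|easy].
  - exists (a - a). apply is_RInt_ind_interval; try lra; intros t Ht; try lra.
    intros Pt. apply Hn; eauto.
Qed.

Lemma RInt_ind_le (P : R -> Prop) (a p q b : R) : a <= p <= q -> q <= b ->
  ex_RInt (fun t => ind (P t) 1) a b -> (forall t, a < t < b -> P t -> p <= t <= q) ->
  RInt (fun t => ind (P t) 1) a b <= q - p.
Proof.
  intros Hp Hq Hi H.
  assert (I : is_RInt (fun t => ind (p <= t <= q) 1) a b (q - p))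
    by (apply is_RInt_ind_interval; intros; lra).
  rewrite <- (is_RInt_unique _ _ _ _ I).
  apply RInt_le; [lra|easy|eexists; exact I|].
  intros t Ht. apply ind_mono; [lra|auto].
Qed.

Lemma RInt_ind_nonneg (P : R -> Prop) (a b : R) : a <= b ->
  ex_RInt (fun t => ind (P t) 1) a b -> 0 <= RInt (fun t => ind (P t) 1) a b.
Proof.
  intros Hab Hi. apply RInt_ge_0; auto. intros t _. unfold ind.
  destruct excluded_middle_informative; lra.
Qed.

(** The order of [p] and [q] is left open because ends moved along affine functions may cross; the
    bound is then negative. *)
Lemma RInt_ind_ge (P : R -> Prop) (a p q b : R) : a <= b -> a <= p -> q <= b ->
  ex_RInt (fun t => ind (P t) 1) a b -> (forall t, a < t < b -> p <= t <= q -> P t) ->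
  q - p <= RInt (fun t => ind (P t) 1) a b.
Proof.
  intros Hab Hp Hq Hi H. destruct (Rle_dec p q) as [Hpq|Hpq].
  - assert (I : is_RInt (fun t => ind (p <= t <= q) 1) a b (q - p))
      by (apply is_RInt_ind_interval; intros; lra).
    rewrite <- (is_RInt_unique _ _ _ _ I).
    apply RInt_le; [lra|eexists; exact I|easy|].
    intros t Ht. apply ind_mono; [lra|auto].
  - assert (0 <= RInt (fun t => ind (P t) 1) a b) by (now apply RInt_ind_nonneg). lra.
Qed.

(** * Segments without facilities of P1 *)

(* With [T] the served part of a segment at [x0], its right end is at most [q] and moves at
   least affinely with [x]; the first alternative is that nothing is served. *)
Definition right_bounded (X : R -> Prop) (x0 a b : R) (T : R -> Prop) (U : R -> R -> Prop) :=
  (forall t, a < t < b -> ~ T t) \/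
  exists q c, (forall t, a < t < b -> T t -> t <= q) /\
    forall x, X x -> q + c * (x - x0) <= b /\
      forall t, a < t < b -> t <= q + c * (x - x0) -> U x t.

Lemma right_bounded_mono X x0 a b (T T' : R -> Prop) (U U' : R -> R -> Prop) :
  (forall t, a < t < b -> T' t -> T t) -> (forall x t, U x t -> U' x t) ->
  right_bounded X x0 a b T U -> right_bounded X x0 a b T' U'.
Proof.
  intros HT HU [H|(q & c & H1 & H2)]; [left|right].
  - intros t Ht Tt. apply (H t); auto.
  - exists q, c; split; [auto|]. intros x Hx. destruct (H2 x Hx); auto.
Qed.

(** Whichever bound is larger at [x0] bounds the union there, and its own motion remains a lower
    bound because [U] is shared. No maximum of affine functions arises. *)
Lemma right_bounded_or X x0 a b (T T' : R -> Prop) (U : R -> R -> Prop) :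
  right_bounded X x0 a b T U -> right_bounded X x0 a b T' U ->
  right_bounded X x0 a b (fun t => T t \/ T' t) U.
Proof.
  intros [H|(q & c & H1 & H2)] [H'|(q' & c' & H1' & H2')].
  - left. intros t Ht [Tt|Tt]; [now apply (H t)|now apply (H' t)].
  - right. exists q', c'; split; [|easy].
    intros t Ht [Tt|Tt]; [now elim (H t)|auto].
  - right. exists q, c; split; [|easy].
    intros t Ht [Tt|Tt]; [auto|now elim (H' t)].
  - right. destruct (Rle_dec q q').
    + exists q', c'; split; [|easy]. intros t Ht [Tt|Tt]; [specialize (H1 t Ht Tt); lra|auto].
    + exists q, c; split; [|easy]. intros t Ht [Tt|Tt]; [auto|specialize (H1' t Ht Tt); lra].
Qed.

Lemma right_bounded_ex {A} X x0 a b (l : list A) (T : A -> R -> Prop) (U : A -> R -> R -> Prop) :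
  (forall y, In y l -> right_bounded X x0 a b (T y) (U y)) ->
  right_bounded X x0 a b (fun t => exists y, In y l /\ T y t)
    (fun x t => exists y, In y l /\ U y x t).
Proof.
  induction l as [|y l IH]; intros H.
  - left. now intros t _ [y [[] _]].
  - apply right_bounded_mono with (T := fun t => T y t \/ exists z, In z l /\ T z t)
      (U := fun x t => exists z, In z (y :: l) /\ U z x t); [|auto|apply right_bounded_or].
    + intros t _ [z [[<-|Hz] Tz]]; [auto|right; eauto].
    + apply right_bounded_mono with (T := T y) (U := U y); [auto| |apply H; now left].
      intros x t Uy. exists y; split; [now left|easy].
    + eapply right_bounded_mono; [| |apply IH]; [auto| |intros z Hz; apply H; now right].
      intros x t [z [Hz Uz]]. exists z; split; [now right|easy].
Qed.

(** A virtual facility on the line of the segment, at the affine position [h + s * (x - x0)], that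
    is never closer than the real one. It may lie left of [a]: then it stands for a facility that
    reaches the segment through [a]. *)
Definition source (X : R -> Prop) (x0 a b : R) (f : R -> R -> R) (h s : R) : Prop :=
  forall x, X x -> h + s * (x - x0) <= b /\
    forall t, a <= t <= b -> f x t <= Rabs (t - (h + s * (x - x0))).

(* [f x t] is the distance from the point [t] of the segment [a, b] to a facility of P2 whose
   position depends on the parameter [x], and [D t] is the distance to the facilities of P1. *)
Record site_ok (X : R -> Prop) (x0 a b : R) (D : R -> R) (f : R -> R -> R) : Prop := {
  site_nonneg : forall x t, X x -> a <= t <= b -> 0 <= f x t;
  site_lip : forall x t u, X x -> a <= t <= b -> a <= u <= b -> f x t <= f x u + Rabs (t - u);
  site_cases : exists tau, forall t, a < t < b ->
    f x0 t = f x0 a + (t - a) \/ f x0 t = f x0 b + (b - t) \/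
    f x0 t = Rabs (t - tau) /\ exists s, forall x, X x -> a <= tau + s * (x - x0) <= b /\
      forall u, a <= u <= b -> f x u <= Rabs (u - (tau + s * (x - x0)));
  site_ends : forall e, e = a \/ e = b ->
    (f x0 e <= D e /\ exists s, forall x, X x -> f x e <= D e /\ f x e <= f x0 e + s * (x - x0)) \/
    (D e < f x0 e /\ forall x, X x -> D e <= f x e) }.

(** Without facilities of P1 inside, [D t] is the minimum of [D a + (t - a)] and [D b + (b - t)],
    here split into linear facts for [lra]. *)
Record segment_dist (a b : R) (D : R -> R) : Prop := {
  seg_left : forall t, a <= t <= b -> D t <= D a + (t - a);
  seg_right : forall t, a <= t <= b -> D t <= D b + (b - t);
  seg_cases : forall t, a <= t <= b -> D t = D a + (t - a) \/ D t = D b + (b - t);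
  seg_nonneg : 0 <= D a /\ 0 <= D b }.

Lemma source_right_bounded X x0 a b D f h s : a < b -> segment_dist a b D ->
  source X x0 a b f h s -> (forall x, X x -> D b <= f x b) ->
  right_bounded X x0 a b (fun t => t - h <= D t) (fun x t => f x t <= D b + (b - t)).
Proof.
  (* [(D b + b + h) / 2] is equidistant from [h] and from the facilities of P1 reached through [b]. *)
  intros Hab HD Hs Hb. right. exists ((D b + b + h) / 2), (s / 2). split.
  - intros t Ht HT. assert (H := seg_right _ _ _ HD t). lra.
  - intros x Hx. destruct (Hs x Hx) as [H1 H2].
    replace ((D b + b + h) / 2 + s / 2 * (x - x0))
      with ((D b + b + (h + s * (x - x0))) / 2) by field.
    set (k := h + s * (x - x0)) in *.
    (* P1 is at least as close to [b], hence [D b <= b - k] and the midpoint does not pass [b]. *)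
    assert (Hfb := H2 b). rewrite Rabs_pos_eq in Hfb by lra. specialize (Hb x Hx).
    destruct (seg_nonneg _ _ _ HD) as [_ Db].
    split; [lra|]. intros t Ht Hq. specialize (H2 t ltac:(lra)).
    unfold Rabs in H2. destruct Rcase_abs; lra.
Qed.

(** If P2 holds [b], the Lipschitz property gives the condition on the whole segment. Otherwise no
    route through [b] can win, and the remaining ones, through [a] or direct, behave like a
    [source]. *)
Lemma site_right_bounded X x0 a b D f : a < b -> segment_dist a b D ->
  site_ok X x0 a b D f ->
  right_bounded X x0 a b (fun t => f x0 t <= D t) (fun x t => f x t <= D b + (b - t)).
Proof.
  intros Hab HD Hf. destruct (site_ends _ _ _ _ _ _ Hf b (or_intror eq_refl))
    as [[_ [s Hb]]|[Hlt Hb]].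
  - right. exists b, 0. split; [intros; lra|]. intros x Hx. split; [lra|]. intros t Ht _.
    assert (H := site_lip _ _ _ _ _ _ Hf x t b Hx ltac:(lra) ltac:(lra)).
    destruct (Hb x Hx) as [Hxb _]. rewrite Rabs_minus_sym, Rabs_pos_eq in H by lra. lra.
  - destruct (site_cases _ _ _ _ _ _ Hf) as [tau Hc].
    apply right_bounded_mono with (T := fun t => f x0 a + (t - a) <= D t \/
      (t - tau <= D t /\ exists s, forall x, X x -> a <= tau + s * (x - x0) <= b /\
      forall u, a <= u <= b -> f x u <= Rabs (u - (tau + s * (x - x0)))))
      (U := fun x t => f x t <= D b + (b - t)); [|auto|apply right_bounded_or].
    + intros t Ht HT. assert (H := seg_right _ _ _ HD t ltac:(lra)).
      destruct (Hc t Ht) as [E|[E|[E Hs]]]; [left; lra|lra|right; split; [|easy]].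
      assert (H' := Rle_abs (t - tau)). lra.
    + destruct (site_ends _ _ _ _ _ _ Hf a (or_introl eq_refl)) as [[Ha [s Hs]]|[Ha _]].
      (* A facility at distance [f x0 a] from [a] acts like one at [a - f x0 a]; it recedes to the
         left as the distance grows, hence the slope [- s]. *)
      * eapply right_bounded_mono; [| |apply source_right_bounded
          with (h := a - f x0 a) (s := - s) (f := f) (D := D)]; auto; [simpl; intros; lra|].
        intros x Hx. destruct (Hs x Hx) as [_ Hxa].
        assert (Hpos : 0 <= f x a).
        { apply (site_nonneg _ _ _ _ _ _ Hf); auto; lra. }
        split; [lra|]. intros t Ht.
        assert (H := site_lip _ _ _ _ _ _ Hf x t a Hx ltac:(lra) ltac:(lra)).
        rewrite Rabs_pos_eq in H by lra. eapply Rle_trans; [|apply Rle_abs]. lra.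
      * left. intros t Ht HT. assert (H := seg_left _ _ _ HD t ltac:(lra)). lra.
    + destruct (classic (exists s, forall x, X x -> a <= tau + s * (x - x0) <= b /\
        forall u, a <= u <= b -> f x u <= Rabs (u - (tau + s * (x - x0))))) as [[s Hs]|Hn].
      * eapply right_bounded_mono; [| |apply source_right_bounded
          with (h := tau) (s := s) (f := f) (D := D)]; auto; [simpl; intros; tauto|].
        intros x Hx. destruct (Hs x Hx) as [? ?]; split; [lra|auto].
      * left. intros t _ [_ HT]. auto.
Qed.

(** The reflection of the segment at 0 swaps its ends, so that left ends of served parts follow from
    right ends. *)
Lemma site_ok_opp X x0 a b D f : site_ok X x0 a b D f ->
  site_ok X x0 (- b) (- a) (fun t => D (- t)) (fun x t => f x (- t)).
Proof.
  intros [Hn Hl [tau Hc] He]. split.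
  - intros x t Hx Ht. apply Hn; auto; lra.
  - intros x t u Hx Ht Hu. replace (Rabs (t - u)) with (Rabs (- t - - u))
      by (rewrite <- Rabs_Ropp; f_equal; ring). apply Hl; auto; lra.
  - exists (- tau). intros t Ht. rewrite !Ropp_involutive.
    destruct (Hc (- t) ltac:(lra)) as [H|[H|[H [s Hs]]]]; [right; left; lra|left; lra|].
    right; right. split.
    + rewrite H, <- Rabs_Ropp. f_equal; ring.
    + exists (- s). intros x Hx. destruct (Hs x Hx) as [H1 H2]. split; [lra|].
      intros u Hu. rewrite <- Rabs_Ropp. eapply Rle_trans; [apply H2; lra|].
      right. f_equal; ring.
  - intros e He'. apply He. destruct He'; subst; rewrite Ropp_involutive; auto.
Qed.

Lemma segment_dist_opp a b D : segment_dist a b D ->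
  segment_dist (- b) (- a) (fun t => D (- t)).
Proof.
  intros [H1 H2 H3 H4]. split; rewrite ?Ropp_involutive.
  - intros t Ht. specialize (H2 (- t)). lra.
  - intros t Ht. specialize (H1 (- t)). lra.
  - intros t Ht. destruct (H3 (- t)); lra.
  - tauto.
Qed.

(* Along a segment without facilities of P1 a point is served iff some facility of P2 is no
   farther than the best facility of P1 through either end; the two conditions are
   respectively upward and downward closed, so the served part is an interval. *)
Lemma served_segment_iff (a b : R) (D : R -> R) {A} (g : list A) (dist : A -> R -> R) (t : R) :
  segment_dist a b D -> a <= t <= b ->
  (exists f, In f g /\ dist f t <= D t) <->
  (exists f, In f g /\ dist f t <= D a + (t - a)) /\
  (exists f, In f g /\ dist f t <= D b + (b - t)).
Proof.
  intros HD Ht. assert (H1 := seg_left _ _ _ HD t Ht). assert (H2 := seg_right _ _ _ HD t Ht).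
  split.
  - intros [f [Hf H]]. split; exists f; split; auto; lra.
  - intros [[f [Hf H]] [f' [Hf' H']]].
    destruct (seg_cases _ _ _ HD t Ht) as [E|E]; [exists f|exists f']; split; auto; lra.
Qed.

Lemma served_segment_integrable (a b : R) (D : R -> R) {A} (g : list A) (dist : A -> R -> R) :
  a <= b -> segment_dist a b D ->
  (forall f t u, In f g -> a <= t <= b -> a <= u <= b -> dist f t <= dist f u + Rabs (t - u)) ->
  ex_RInt (fun t => ind (exists f, In f g /\ dist f t <= D t) 1) a b.
Proof.
  intros Hab HD Hl. apply ex_RInt_ind_convex; [easy|].
  intros s t u Hs Ht Hu Ps Pu.
  apply (served_segment_iff a b D g dist) in Ps; [|easy|lra].
  apply (served_segment_iff a b D g dist) in Pu; [|easy|lra].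
  apply (served_segment_iff a b D g dist); [easy|lra|].
  destruct Ps as [[f [Hf Hfs]] _], Pu as [_ [f' [Hf' Hfu]]].
  split; [exists f|exists f']; split; auto.
  - assert (H := Hl f t s Hf ltac:(lra) ltac:(lra)). rewrite Rabs_pos_eq in H by lra. lra.
  - assert (H := Hl f' t u Hf' ltac:(lra) ltac:(lra)).
    rewrite Rabs_minus_sym, Rabs_pos_eq in H by lra. lra.
Qed.

(** At [x0] the served part lies between [- p] and [q]; at [x] it contains everything between the
    moved ends. The two lengths thus differ by at least [(c + c') * (x - x0)]. *)
Lemma served_segment_affine_minorant X x0 a b D (sites : list (R -> R -> R)) :
  a < b -> X x0 -> segment_dist a b D -> (forall f, In f sites -> site_ok X x0 a b D f) ->
  exists c, forall x, X x ->
    RInt (fun t => ind (exists f, In f sites /\ f x0 t <= D t) 1) a b + c * (x - x0) <=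
    RInt (fun t => ind (exists f, In f sites /\ f x t <= D t) 1) a b.
Proof.
  intros Hab H0 HD Hok.
  assert (Hint : forall x, X x ->
    ex_RInt (fun t => ind (exists f, In f sites /\ f x t <= D t) 1) a b).
  { intros x Hx. apply served_segment_integrable with (dist := fun f => f x); [lra|easy|].
    intros f t u Hf Ht Hu. now apply (site_lip _ _ _ _ _ _ (Hok f Hf)). }
  assert (HR : right_bounded X x0 a b (fun t => exists f, In f sites /\ f x0 t <= D t)
     (fun x t => exists f, In f sites /\ f x t <= D b + (b - t))).
  { apply right_bounded_ex with (T := fun f t => f x0 t <= D t)
      (U := fun f x t => f x t <= D b + (b - t)).
    intros f Hf. apply site_right_bounded; auto. }
  assert (HL : right_bounded X x0 (- b) (- a)
     (fun t => exists f, In f sites /\ f x0 (- t) <= D (- t))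
     (fun x t => exists f, In f sites /\ f x (- t) <= D a + (- a - t))).
  { apply right_bounded_ex with (T := fun f t => f x0 (- t) <= D (- t))
      (U := fun f x t => f x (- t) <= D a + (- a - t)).
    intros f Hf. replace (D a) with (D (- - a)) by (f_equal; ring).
    apply (site_right_bounded X x0 (- b) (- a) (fun t => D (- t)) (fun x t => f x (- t)));
      [lra|now apply segment_dist_opp|now apply site_ok_opp, Hok]. }
  (* A segment without served points at [x0] has the minorant 0, since lengths are nonnegative. *)
  assert (Hempty : (forall t, a < t < b -> ~ exists f, In f sites /\ f x0 t <= D t) ->
    exists c, forall x, X x ->
    RInt (fun t => ind (exists f, In f sites /\ f x0 t <= D t) 1) a b + c * (x - x0) <=
    RInt (fun t => ind (exists f, In f sites /\ f x t <= D t) 1) a b).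
  { intros Hn. exists 0. intros x Hx.
    assert (H1 := RInt_ind_nonneg _ a b ltac:(lra) (Hint x Hx)).
    assert (H2 : RInt (fun t => ind (exists f, In f sites /\ f x0 t <= D t) 1) a b <= a - a);
      [|lra].
    apply RInt_ind_le; auto; try lra. intros t Ht Pt. now elim (Hn t Ht). }
  destruct HR as [HR|(q & c & HR1 & HR2)]; [auto|].
  destruct HL as [HL|(p & c' & HL1 & HL2)].
  { apply Hempty. intros t Ht Pt. apply (HL (- t)); [lra|]. rewrite Ropp_involutive; easy. }
  (* The two bounds may come from different facilities and be in the wrong order; then nothing is
     served at [x0]. *)
  destruct (Rle_dec (- p) q) as [Hpq|Hpq].
  - exists (c + c'). intros x Hx.
    assert (Hup : RInt (fun t => ind (exists f, In f sites /\ f x0 t <= D t) 1) a b <= q - - p).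
    { destruct (HR2 x0 H0) as [? _], (HL2 x0 H0) as [? _].
      apply RInt_ind_le; auto; try lra. intros t Ht Pt.
      assert (t <= q) by (apply HR1; auto).
      assert (- t <= p) by (apply HL1; [lra|rewrite Ropp_involutive; auto]). lra. }
    destruct (HR2 x Hx) as [Hq Hq'], (HL2 x Hx) as [Hp Hp'].
    assert (Hlo : q + c * (x - x0) - - (p + c' * (x - x0)) <=
      RInt (fun t => ind (exists f, In f sites /\ f x t <= D t) 1) a b).
    { apply RInt_ind_ge; auto; try lra. intros t Ht Hpt. 
      apply (served_segment_iff a b D sites (fun f => f x)); [easy|lra|]. split.
      - destruct (Hp' (- t)) as [f [Hf H]]; [lra|lra|].
        exists f; split; [easy|]. rewrite Ropp_involutive in H. lra.
      - apply Hq'; lra. }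
    lra.
  - apply Hempty. intros t Ht Pt.
    assert (t <= q) by (apply HR1; auto).
    assert (- t <= p) by (apply HL1; [lra|rewrite Ropp_involutive; auto]). lra.
Qed.
(** * Distances in the graph *)

Section Graph.

Context (n : nat) (E : list edge) (wv : nat -> R) (HG : good_graph n E wv).

Notation src i := (e_src (nth_edge E i)).
Notation dst i := (e_dst (nth_edge E i)).
Notation len i := (e_len (nth_edge E i)).
Notation d := (gdist E).
Notation valid := (valid_point n E).

Lemma edge_bounds (i : nat) : (i < length E)%nat ->
  (src i < n)%nat /\ (dst i < n)%nat /\ 0 < len i.
Proof.
  intros Hi.
  destruct (proj1 (proj2 HG) (nth_edge E i)) as [H1 [H2 [_ H3]]]; [now apply nth_In|auto].
Qed.

Lemma min_len : exists mu, 0 < mu /\ forall i, (i < length E)%nat -> mu <= len i.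
Proof.
  assert (H : forall l : list edge, (forall e, In e l -> 0 < e_len e) ->
    exists mu, 0 < mu /\ forall e, In e l -> mu <= e_len e).
  { induction l as [|e l IH]; intros H; [exists 1; split; [lra|easy]|].
    destruct IH as [mu [Hmu H']]; [intros; apply H; now right|].
    assert (He := H e (or_introl eq_refl)).
    exists (Rmin mu (e_len e)); split; [now apply Rmin_glb_lt|].
    intros e' [<-|He']; [apply Rmin_r|]. eapply Rle_trans; [apply Rmin_l|auto]. }
  destruct (H E) as [mu [Hmu H']]; [intros e He; now apply HG|].
  exists mu; split; [easy|]. intros i Hi. apply H'. now apply nth_In.
Qed.

Lemma walk_app (u v w : nat) (l l' : list nat) :
  walk E u v l -> walk E v w l' -> walk E u w (l ++ l').
Proof.
  revert u; induction l as [|i l IH]; simpl; intros u H H'; [now subst|].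
  destruct H as [Hi [[H1 H2]|[H1 H2]]]; split; auto.
Qed.

Lemma walk_len_app (l l' : list nat) : walk_len E (l ++ l') = walk_len E l + walk_len E l'.
Proof. induction l as [|i l IH]; simpl; [|rewrite IH]; lra. Qed.

Lemma walk_edges (u v : nat) (l : list nat) : walk E u v l -> incl l (seq 0 (length E)).
Proof.
  revert u; induction l as [|i l IH]; simpl; intros u H; [intros x []|].
  intros x [<-|Hx]; [apply in_seq; lia|].
  destruct H as [_ [[_ H]|[_ H]]]; eapply IH; eauto.
Qed.

Lemma walk_len_ge (mu : R) (l : list nat) :
  (forall i, (i < length E)%nat -> mu <= len i) ->
  incl l (seq 0 (length E)) -> INR (length l) * mu <= walk_len E l.
Proof.
  intros Hmu; induction l as [|i l IH]; intros H; [simpl; lra|].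
  change (length (i :: l)) with (S (length l)). rewrite S_INR; simpl.
  assert (mu <= len i). { apply Hmu. specialize (H i (or_introl eq_refl)). apply in_seq in H; lia. }
  assert (INR (length l) * mu <= walk_len E l) by (apply IH; intros x Hx; apply H; now right).
  lra.
Qed.

Lemma walk_len_nonneg (u v : nat) (l : list nat) : walk E u v l -> 0 <= walk_len E l.
Proof.
  intros H. replace 0 with (INR (length l) * 0) by ring.
  apply walk_len_ge; [|eapply walk_edges; eauto].
  intros i Hi. apply edge_bounds in Hi. lra.
Qed.

Lemma access_valid (p : point) (a : nat) (c : R) :
  valid p -> In (a, c) (access E p) -> (a < n)%nat /\ 0 <= c.
Proof.
  destruct p as [v|i t]; simpl; intros Hv H.
  - destruct H as [H|[]]. injection H as <- <-. split; [easy|lra].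
  - destruct Hv as [Hi Ht]. destruct (edge_bounds i Hi) as [? [? ?]].
    destruct H as [H|[H|[]]]; injection H as <- <-; split; auto; lra.
Qed.

Lemma path_len_exists (p q : point) : valid p -> valid q -> exists r, path_len E p q r.
Proof.
  intros Hp Hq.
  assert (Ha : forall p, exists a c, In (a, c) (access E p))
    by (intros [v|i t]; simpl; eauto).
  destruct (Ha p) as [a [c1 H1]], (Ha q) as [b [c2 H2]].
  assert (Hab : exists l, walk E a b l)
    by (apply HG; [apply (access_valid p a c1)|apply (access_valid q b c2)]; auto).
  destruct Hab as [l Hl].
  exists (c1 + walk_len E l + c2). right. exists a, c1, b, c2, l; auto.
Qed.

Lemma path_len_nonneg (p q : point) (r : R) :
  valid p -> valid q -> path_len E p q r -> 0 <= r.
Proof.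
  intros Hp Hq [(i & t & s & _ & _ & ->)|(a & c1 & b & c2 & l & Ha & Hb & Hw & ->)].
  - apply Rabs_pos.
  - apply access_valid in Ha; [|easy]. apply access_valid in Hb; [|easy].
    apply walk_len_nonneg in Hw. lra.
Qed.

(* Edge lengths are bounded below, so only finitely many walks are shorter than a given bound. *)
Lemma path_len_finite (p q : point) (r0 : R) : valid p -> valid q ->
  finite (fun r => path_len E p q r /\ r <= r0).
Proof.
  intros Hp Hq. destruct min_len as [mu [Hmu Hle]].
  destruct (INR_unbounded (r0 / mu)) as [N HN].
  destruct (finite_lists (seq 0 (length E)) N) as [LL HLL].
  apply finite_sub with (fun r =>
    r = match p, q with PE _ t, PE _ s => Rabs (t - s) | _, _ => 0 end \/
    exists x, In x (access E p) /\ exists y, In y (access E q) /\ exists l, In l LL /\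
      r = snd x + walk_len E l + snd y).
  - intros r [[(i & t & s & -> & -> & ->)|(a & c1 & b & c2 & l & Ha & Hb & Hw & ->)] Hr];
      [now left|right].
    exists (a, c1); split; [easy|]. exists (b, c2); split; [easy|]. exists l; split; [|easy].
    apply HLL; split; [|eapply walk_edges; eauto].
    apply access_valid in Ha; [|easy]. apply access_valid in Hb; [|easy].
    assert (H := walk_len_ge mu l Hle (walk_edges _ _ _ Hw)).
    apply INR_le. apply Rmult_le_reg_r with mu; [easy|].
    assert (r0 / mu * mu < INR N * mu) by (now apply Rmult_lt_compat_r).
    replace (r0 / mu * mu) with r0 in * by (field; lra). lra.
  - apply finite_or; [apply finite_single|].
    do 3 (apply finite_ex; intros ? _). apply finite_single.
Qed.

(** The minimum selected by [epsilon] exists because only finitely many lengths do not exceed that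
    of one route, [r0]. *)
Lemma gdist_spec (p q : point) : valid p -> valid q ->
  path_len E p q (d p q) /\ forall r, path_len E p q r -> d p q <= r.
Proof.
  intros Hp Hq. unfold gdist. apply epsilon_spec.
  destruct (path_len_exists p q Hp Hq) as [r0 H0].
  destruct (finite_argmax Ropp _ (path_len_finite p q r0 Hp Hq)) as [r [[Hr Hr0] Hmin]].
  - exists r0; split; [easy|lra].
  - exists r; split; [easy|]. intros r' Hr'.
    destruct (Rle_dec r' r0) as [Hle|Hle]; [|lra].
    specialize (Hmin r' (conj Hr' Hle)); lra.
Qed.

Lemma gdist_nonneg (p q : point) : valid p -> valid q -> 0 <= d p q.
Proof. intros Hp Hq. eapply path_len_nonneg, gdist_spec; eauto. Qed.

Lemma gdist_PE_src (i : nat) (t : R) (q : point) : valid (PE i t) -> valid q ->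
  d (PE i t) q <= t + d (PV (src i)) q.
Proof.
  intros Hp Hq. apply (gdist_spec _ q Hp Hq).
  assert (Hs : valid (PV (src i))) by (apply edge_bounds, Hp).
  destruct (gdist_spec _ q Hs Hq)
    as [[(j & u & s & H & _)|(a & c1 & b & c2 & l & Ha & Hb & Hw & ->)] _]; [easy|].
  destruct Ha as [Ha|[]]; injection Ha as <- <-.
  right. exists (src i), t, b, c2, l; repeat split; auto; [now left|lra].
Qed.

Lemma gdist_PE_dst (i : nat) (t : R) (q : point) : valid (PE i t) -> valid q ->
  d (PE i t) q <= len i - t + d (PV (dst i)) q.
Proof.
  intros Hp Hq. apply (gdist_spec _ q Hp Hq).
  assert (Hs : valid (PV (dst i))) by (apply edge_bounds, Hp).
  destruct (gdist_spec _ q Hs Hq)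
    as [[(j & u & s & H & _)|(a & c1 & b & c2 & l & Ha & Hb & Hw & ->)] _]; [easy|].
  destruct Ha as [Ha|[]]; injection Ha as <- <-.
  right. exists (dst i), (len i - t), b, c2, l; repeat split; auto; [right; now left|lra].
Qed.

Lemma gdist_PE_cases (i : nat) (t : R) (q : point) : valid (PE i t) -> valid q ->
  d (PE i t) q = t + d (PV (src i)) q \/ d (PE i t) q = len i - t + d (PV (dst i)) q \/
  exists s, q = PE i s /\ d (PE i t) q = Rabs (t - s).
Proof.
  intros Hp Hq.
  destruct (gdist_spec _ q Hp Hq)
    as [[(j & u & s & H & H' & Hr)|(a & c1 & b & c2 & l & Ha & Hb & Hw & Hr)] _].
  - injection H as <- <-. right; right. eauto.
  - destruct Ha as [Ha|[Ha|[]]]; injection Ha as <- <-; [left|right; left].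
    + apply Rle_antisym; [now apply gdist_PE_src|].
      assert (d (PV (src i)) q <= 0 + walk_len E l + c2); [|lra].
      apply gdist_spec; [apply edge_bounds, Hp|easy|].
      right. exists (src i), 0, b, c2, l. repeat split; auto. now left.
    + apply Rle_antisym; [now apply gdist_PE_dst|].
      assert (d (PV (dst i)) q <= 0 + walk_len E l + c2); [|lra].
      apply gdist_spec; [apply edge_bounds, Hp|easy|].
      right. exists (dst i), 0, b, c2, l. repeat split; auto. now left.
Qed.

Lemma gdist_src_dst (i : nat) (q : point) : (i < length E)%nat -> valid q ->
  d (PV (src i)) q <= len i + d (PV (dst i)) q /\ d (PV (dst i)) q <= len i + d (PV (src i)) q.
Proof.
  intros Hi Hq. destruct (edge_bounds i Hi) as [Hs [Hd _]].
  split; (apply gdist_spec; [easy|easy|]);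
    [destruct (gdist_spec (PV (dst i)) q Hd Hq) as [H _]
    |destruct (gdist_spec (PV (src i)) q Hs Hq) as [H _]];
    (destruct H as [(j & u & s & H & _)|(a & c1 & b & c2 & l & Ha & Hb & Hw & ->)]; [easy|]);
    (destruct Ha as [Ha|[]]; injection Ha as <- <-; right).
  - exists (src i), 0, b, c2, (i :: l). repeat split; auto; simpl; auto; try lra.
  - exists (dst i), 0, b, c2, (i :: l). repeat split; auto; simpl; auto; try lra.
Qed.

Lemma gdist_VV (u v : nat) : (u < n)%nat -> (v < n)%nat ->
  exists l, walk E u v l /\ d (PV u) (PV v) = walk_len E l.
Proof.
  intros Hu Hv. destruct (gdist_spec (PV u) (PV v) Hu Hv)
    as [[(j & x & s & H & _)|(a & c1 & b & c2 & l & Ha & Hb & Hw & H)] _]; [easy|].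
  destruct Ha as [Ha|[]]; injection Ha as <- <-.
  destruct Hb as [Hb|[]]; injection Hb as <- <-.
  exists l; split; [easy|lra].
Qed.

Lemma gdist_VV_le (u v : nat) (l : list nat) : (u < n)%nat -> (v < n)%nat ->
  walk E u v l -> d (PV u) (PV v) <= walk_len E l.
Proof.
  intros Hu Hv Hw. apply gdist_spec; auto. right.
  exists u, 0, v, 0, l. repeat split; simpl; auto; lra.
Qed.

(** In [t] this is a minimum of two affine functions, hence concave; [vertex_status] and
    [finite_gamma0] rest on this form. *)
Lemma gdist_VE (v i : nat) (t : R) : (v < n)%nat -> valid (PE i t) ->
  d (PV v) (PE i t) =
  Rmin (d (PV v) (PV (src i)) + t) (d (PV v) (PV (dst i)) + (len i - t)).
Proof.
  intros Hv Hq. destruct (edge_bounds i (proj1 Hq)) as [Hs [Hd _]].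
  assert (H := gdist_spec (PV v) (PE i t) Hv Hq). destruct H as [Hp Hle].
  apply Rle_antisym.
  - apply Rmin_glb; apply Hle; right.
    + destruct (gdist_VV v (src i) Hv Hs) as [l [Hw ->]].
      exists v, 0, (src i), t, l. repeat split; simpl; auto; lra.
    + destruct (gdist_VV v (dst i) Hv Hd) as [l [Hw ->]].
      exists v, 0, (dst i), (len i - t), l. repeat split; simpl; auto; lra.
  - destruct Hp as [(j & x & s & H & _)|(a & c1 & b & c2 & l & Ha & Hb & Hw & ->)]; [easy|].
    destruct Ha as [Ha|[]]; injection Ha as <- <-.
    destruct Hb as [Hb|[Hb|[]]]; injection Hb as <- <-.
    + eapply Rle_trans; [apply Rmin_l|].
      assert (H := gdist_VV_le _ _ _ Hv Hs Hw). lra.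
    + eapply Rle_trans; [apply Rmin_r|].
      assert (H := gdist_VV_le _ _ _ Hv Hd Hw). lra.
Qed.

Lemma gdist_VV_src_dst (v i : nat) : (v < n)%nat -> (i < length E)%nat ->
  d (PV v) (PV (src i)) <= d (PV v) (PV (dst i)) + len i /\
  d (PV v) (PV (dst i)) <= d (PV v) (PV (src i)) + len i.
Proof.
  intros Hv Hi. destruct (edge_bounds i Hi) as [Hs [Hd _]].
  destruct (gdist_VV v (src i) Hv Hs) as [l [Hw H]], (gdist_VV v (dst i) Hv Hd) as [l' [Hw' H']].
  split.
  - eapply Rle_trans; [apply (gdist_VV_le v (src i) (l' ++ [i])); auto|].
    + eapply walk_app; [exact Hw'|]. simpl; auto.
    + rewrite walk_len_app, H'; simpl; lra.
  - eapply Rle_trans; [apply (gdist_VV_le v (dst i) (l ++ [i])); auto|].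
    + eapply walk_app; [exact Hw|]. simpl; auto.
    + rewrite walk_len_app, H; simpl; lra.
Qed.

Lemma gdist_VV_refl (v : nat) : (v < n)%nat -> d (PV v) (PV v) = 0.
Proof.
  intros Hv. apply Rle_antisym; [|apply gdist_nonneg; auto].
  apply (gdist_VV_le v v []); simpl; auto.
Qed.

(** * Points of a closed edge by their coordinate *)

(** [PE] covers only the interior of an edge. Here the ends are the vertices, so that a facility can
    be moved on the closed edge. *)
Definition edge_pt (i : nat) (t : R) : point :=
  if Req_dec_T t 0 then PV (src i) else if Req_dec_T t (len i) then PV (dst i) else PE i t.

Lemma edge_pt_0 (i : nat) : edge_pt i 0 = PV (src i).
Proof. unfold edge_pt. destruct (Req_dec_T 0 0); [easy|lra]. Qed.

Lemma edge_pt_len (i : nat) : (i < length E)%nat -> edge_pt i (len i) = PV (dst i).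
Proof.
  intros Hi. apply edge_bounds in Hi. unfold edge_pt.
  destruct (Req_dec_T (len i) 0); [lra|]. destruct (Req_dec_T (len i) (len i)); [easy|lra].
Qed.

Lemma edge_pt_in (i : nat) (t : R) : 0 < t < len i -> edge_pt i t = PE i t.
Proof.
  intros Ht. unfold edge_pt.
  destruct (Req_dec_T t 0); [lra|]. destruct (Req_dec_T t (len i)); [lra|easy].
Qed.

(** [P] also takes the coordinate, so that formulas in [t] are checked at the ends with [0] or
    [len i] in its place. *)
Lemma edge_pt_ind (i : nat) (t : R) (P : R -> point -> Prop) :
  (i < length E)%nat -> 0 <= t <= len i ->
  P 0 (PV (src i)) -> P (len i) (PV (dst i)) -> (0 < t < len i -> P t (PE i t)) ->
  P t (edge_pt i t).
Proof.
  intros Hi Ht H0 H1 H. unfold edge_pt.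
  destruct (Req_dec_T t 0) as [->|]; [easy|].
  destruct (Req_dec_T t (len i)) as [->|]; [easy|]. apply H; lra.
Qed.

Lemma edge_pt_valid (i : nat) (t : R) :
  (i < length E)%nat -> 0 <= t <= len i -> valid (edge_pt i t).
Proof.
  intros Hi Ht. apply edge_pt_ind; auto; try apply edge_bounds; auto. now split.
Qed.

Lemma gdist_to_edge_pt (v i : nat) (t : R) :
  (v < n)%nat -> (i < length E)%nat -> 0 <= t <= len i ->
  d (PV v) (edge_pt i t) =
  Rmin (d (PV v) (PV (src i)) + t) (d (PV v) (PV (dst i)) + (len i - t)).
Proof.
  intros Hv Hi Ht. assert (H := gdist_VV_src_dst v i Hv Hi).
  apply (edge_pt_ind i t (fun t p => d (PV v) p = Rmin (d (PV v) (PV (src i)) + t)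
    (d (PV v) (PV (dst i)) + (len i - t)))); auto.
  - rewrite Rmin_left; lra.
  - rewrite Rmin_right; lra.
  - intros H'. now apply gdist_VE.
Qed.

Lemma gdist_edge_pt_src (i : nat) (t : R) (q : point) :
  (i < length E)%nat -> 0 <= t <= len i -> valid q ->
  d (edge_pt i t) q <= t + d (PV (src i)) q.
Proof.
  intros Hi Ht Hq. assert (H := gdist_src_dst i q Hi Hq).
  apply (edge_pt_ind i t (fun t p => d p q <= t + d (PV (src i)) q)); auto; try lra.
  intros. apply gdist_PE_src; auto. now split.
Qed.

Lemma gdist_edge_pt_dst (i : nat) (t : R) (q : point) :
  (i < length E)%nat -> 0 <= t <= len i -> valid q ->
  d (edge_pt i t) q <= len i - t + d (PV (dst i)) q.
Proof.
  intros Hi Ht Hq. assert (H := gdist_src_dst i q Hi Hq).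
  apply (edge_pt_ind i t (fun t p => d p q <= len i - t + d (PV (dst i)) q)); auto; try lra.
  intros. apply gdist_PE_dst; auto. now split.
Qed.

Lemma gdist_edge_pt_cases (i : nat) (t : R) (q : point) :
  (i < length E)%nat -> 0 <= t <= len i -> valid q ->
  d (edge_pt i t) q = t + d (PV (src i)) q \/
  d (edge_pt i t) q = len i - t + d (PV (dst i)) q \/
  exists s, q = PE i s /\ d (edge_pt i t) q = Rabs (t - s).
Proof.
  intros Hi Ht Hq.
  apply (edge_pt_ind i t (fun t p => d p q = t + d (PV (src i)) q \/
    d p q = len i - t + d (PV (dst i)) q \/ exists s, q = PE i s /\ d p q = Rabs (t - s))); auto;
    [left; lra|right; left; lra|].
  intros. apply gdist_PE_cases; auto. now split.
Qed.

Lemma gdist_edge_pt_direct (i : nat) (t s : R) :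
  (i < length E)%nat -> 0 <= t <= len i -> 0 <= s <= len i ->
  d (edge_pt i t) (edge_pt i s) <= Rabs (t - s).
Proof.
  intros Hi Ht Hs. destruct (edge_bounds i Hi) as [Hsrc [Hdst _]].
  assert (Vs := edge_pt_valid i s Hi Hs).
  assert (H1 := gdist_VV_refl _ Hsrc). assert (H2 := gdist_VV_refl _ Hdst).
  assert (A : d (PV (src i)) (edge_pt i s) <= s).
  { rewrite gdist_to_edge_pt; auto. eapply Rle_trans; [apply Rmin_l|lra]. }
  assert (B : d (PV (dst i)) (edge_pt i s) <= len i - s).
  { rewrite gdist_to_edge_pt; auto. eapply Rle_trans; [apply Rmin_r|lra]. }
  assert (C := gdist_edge_pt_src i t _ Hi Ht Vs).
  assert (D := gdist_edge_pt_dst i t _ Hi Ht Vs).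
  destruct (Req_dec_T t 0) as [->|]; [unfold Rabs; destruct Rcase_abs; lra|].
  destruct (Req_dec_T t (len i)) as [->|]; [unfold Rabs; destruct Rcase_abs; lra|].
  destruct (Req_dec_T s 0) as [->|];
    [rewrite edge_pt_0 in *; unfold Rabs; destruct Rcase_abs; lra|].
  destruct (Req_dec_T s (len i)) as [->|];
    [rewrite (edge_pt_len i) in * by easy; unfold Rabs; destruct Rcase_abs; lra|].
  rewrite !edge_pt_in in * by lra.
  apply gdist_spec; [split; auto; lra|easy|]. left. exists i, t, s; auto.
Qed.

Lemma gdist_edge_pt_lip (i : nat) (t t' : R) (q : point) :
  (i < length E)%nat -> 0 <= t <= len i -> 0 <= t' <= len i -> valid q ->
  d (edge_pt i t) q <= d (edge_pt i t') q + Rabs (t - t').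
Proof.
  intros Hi Ht Ht' Hq.
  assert (A := gdist_edge_pt_src i t q Hi Ht Hq).
  assert (B := gdist_edge_pt_dst i t q Hi Ht Hq).
  destruct (gdist_edge_pt_cases i t' q Hi Ht' Hq) as [H|[H|[s [-> H]]]]; rewrite H.
  - unfold Rabs; destruct Rcase_abs; lra.
  - unfold Rabs; destruct Rcase_abs; lra.
  - destruct Hq as [_ Hs]. rewrite <- (edge_pt_in i s) by easy.
    eapply Rle_trans; [apply gdist_edge_pt_direct; auto; lra|].
    unfold Rabs; repeat destruct Rcase_abs; lra.
Qed.

(** A shortest route from the segment to a point outside has to leave it through [a] or [b]. *)
Lemma gdist_segment (i : nat) (a b t : R) (q : point) :
  (i < length E)%nat -> 0 <= a -> b <= len i -> a <= t <= b -> valid q ->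
  d (edge_pt i t) q = d (edge_pt i a) q + (t - a) \/
  d (edge_pt i t) q = d (edge_pt i b) q + (b - t) \/
  exists s, a < s < b /\ q = PE i s /\ d (edge_pt i t) q = Rabs (t - s).
Proof.
  intros Hi Ha Hb Ht Hq.
  assert (La : d (edge_pt i t) q <= d (edge_pt i a) q + (t - a)).
  { rewrite <- (Rabs_pos_eq (t - a)) by lra. apply gdist_edge_pt_lip; auto; lra. }
  assert (Lb : d (edge_pt i t) q <= d (edge_pt i b) q + (b - t)).
  { rewrite <- (Rabs_pos_eq (b - t)) by lra. rewrite Rabs_minus_sym.
    apply gdist_edge_pt_lip; auto; lra. }
  assert (A := gdist_edge_pt_src i a q Hi ltac:(lra) Hq).
  assert (B := gdist_edge_pt_dst i b q Hi ltac:(lra) Hq).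
  destruct (gdist_edge_pt_cases i t q Hi ltac:(lra) Hq) as [H|[H|[s [-> H]]]];
    [left; lra|right; left; lra|].
  (* The route runs along the edge to [s]; if [s] is not strictly inside the segment, it passes an
     end on its way. *)
  destruct (Rle_dec s a) as [Hsa|Hsa];
    [left|destruct (Rle_dec b s) as [Hsb|Hsb]; [right; left|right; right]].
  - assert (C := gdist_edge_pt_direct i a s Hi ltac:(lra) ltac:(destruct Hq; lra)).
    rewrite (edge_pt_in i s) in C by apply Hq.
    rewrite Rabs_pos_eq in C by lra. rewrite Rabs_pos_eq in H by lra. lra.
  - assert (C := gdist_edge_pt_direct i b s Hi ltac:(lra) ltac:(destruct Hq; lra)).
    rewrite (edge_pt_in i s) in C by apply Hq.
    rewrite Rabs_minus_sym, Rabs_pos_eq in C by lra.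
    rewrite Rabs_minus_sym, Rabs_pos_eq in H by lra. lra.
  - exists s; repeat split; auto; lra.
Qed.

(** Makes P1 strictly closer at its own locations, as [moving_site_ok] needs for segment ends in
    [F]. *)
Lemma edge_pt_gdist_pos (i j : nat) (t s : R) :
  (i < length E)%nat -> 0 <= t <= len i -> valid (PE j s) ->
  edge_pt i t <> PE j s -> 0 < d (edge_pt i t) (PE j s).
Proof.
  intros Hi Ht Hq Hne.
  assert (HV : forall v, (v < n)%nat -> 0 < d (PV v) (PE j s)).
  { intros v Hv. rewrite gdist_VE by auto.
    destruct Hq as [Hj Hs]. destruct (edge_bounds j Hj) as [Hsrc [Hdst _]].
    assert (0 <= d (PV v) (PV (src j))) by (now apply gdist_nonneg).
    assert (0 <= d (PV v) (PV (dst j))) by (now apply gdist_nonneg).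
    apply Rmin_glb_lt; lra. }
  destruct (edge_bounds i Hi) as [Hsrc [Hdst _]].
  assert (H1 := HV _ Hsrc). assert (H2 := HV _ Hdst).
  destruct (gdist_edge_pt_cases i t _ Hi Ht Hq) as [H|[H|[s' [H' H]]]]; rewrite H; try lra.
  injection H' as -> ->. apply Rabs_pos_lt. intros H'.
  apply Hne. rewrite edge_pt_in; [f_equal; lra|]. destruct Hq; lra.
Qed.

(** The list contains only finitely many points of edge 0, so all sufficiently small positive
    coordinates on it are free. *)
Lemma fresh_point (l : list point) : exists p, valid p /\ ~ In p l.
Proof.
  assert (H : exists e0, 0 < e0 /\ forall t, 0 < t < e0 -> ~ In (PE 0 t) l).
  { induction l as [|p l [e0 [He0 IH]]]; [exists 1; split; [lra|easy]|].
    destruct (classic (exists t, 0 < t /\ p = PE 0 t)) as [[t [Ht ->]]|Hn].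
    - exists (Rmin e0 t). split; [now apply Rmin_glb_lt|]. intros u Hu.
      assert (H1 := Rmin_l e0 t). assert (H2 := Rmin_r e0 t).
      intros [H|H]; [injection H; lra|]. apply (IH u); [lra|easy].
    - exists e0; split; [easy|]. intros t Ht [H|H]; [|now apply (IH t)].
      apply Hn. exists t; split; [lra|easy]. }
  destruct H as [e0 [He0 H]].
  assert (H0 : (0 < length E)%nat).
  { apply Nat.neq_0_lt_0. intros H0. now apply length_zero_iff_nil, (proj1 HG) in H0. }
  destruct (edge_bounds 0 H0) as [_ [_ Hlen]].
  exists (PE 0 (Rmin e0 (len 0%nat) / 2)).
  assert (H1 := Rmin_l e0 (len 0%nat)). assert (H2 := Rmin_r e0 (len 0%nat)).
  assert (H3 : 0 < Rmin e0 (len 0%nat)) by now apply Rmin_glb_lt.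
  split; [split; [easy|lra]|apply H; lra].
Qed.

(** * Distance to the facilities of P1 along an edge *)

Context (F : list point) (HF : forall p, In p F -> valid p) (HF0 : F <> []).

Notation D p := (dist_set E p F).

Lemma dist_set_nonneg (p : point) : valid p -> 0 <= D p.
Proof.
  intros Hp. destruct (dist_set_attained E p F HF0) as [q [Hq <-]].
  apply gdist_nonneg; auto.
Qed.

Lemma dist_set_lip (i : nat) (t u : R) :
  (i < length E)%nat -> 0 <= t <= len i -> 0 <= u <= len i ->
  D (edge_pt i t) <= D (edge_pt i u) + Rabs (t - u).
Proof.
  intros Hi Ht Hu. destruct (dist_set_attained E (edge_pt i u) F HF0) as [q [Hq <-]].
  eapply Rle_trans; [apply dist_set_le, Hq|]. apply gdist_edge_pt_lip; auto.
Qed.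

Lemma dist_set_segment (i : nat) (a b : R) :
  (i < length E)%nat -> 0 <= a -> a < b -> b <= len i ->
  (forall s, a < s < b -> ~ In (PE i s) F) ->
  segment_dist a b (fun t => D (edge_pt i t)).
Proof.
  intros Hi Ha Hab Hb Hfree.
  assert (L : forall t, a <= t <= b -> D (edge_pt i t) <= D (edge_pt i a) + (t - a)).
  { intros t Ht. rewrite <- (Rabs_pos_eq (t - a)) by lra. apply dist_set_lip; auto; lra. }
  assert (R : forall t, a <= t <= b -> D (edge_pt i t) <= D (edge_pt i b) + (b - t)).
  { intros t Ht. rewrite <- (Rabs_pos_eq (b - t)) by lra. rewrite Rabs_minus_sym.
    apply dist_set_lip; auto; lra. }
  split; auto.
  - intros t Ht. specialize (L t Ht). specialize (R t Ht).
    destruct (dist_set_attained E (edge_pt i t) F HF0) as [q [Hq Hd]].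
    assert (A := dist_set_le E (edge_pt i a) q F Hq).
    assert (B := dist_set_le E (edge_pt i b) q F Hq).
    destruct (gdist_segment i a b t q Hi Ha Hb Ht (HF q Hq)) as [H|[H|[s [Hs [-> _]]]]];
      [left; lra|right; lra|]. now elim (Hfree s).
  - split; apply dist_set_nonneg, edge_pt_valid; auto; lra.
Qed.

Lemma dist_set_edge_pt_in (i : nat) (t : R) :
  (i < length E)%nat -> 0 <= t <= len i -> In (edge_pt i t) F -> D (edge_pt i t) = 0.
Proof.
  intros Hi Ht H. apply Rle_antisym; [|now apply dist_set_nonneg, edge_pt_valid].
  eapply Rle_trans; [apply dist_set_le, H|].
  eapply Rle_trans; [now apply gdist_edge_pt_direct|].
  rewrite Rminus_diag, Rabs_R0. lra.
Qed.

(** Cutting the edge at the facilities of P1 inside it leaves segments to which [dist_set_segment]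
    applies. The induction is over a list [ts] that contains the facilities of P1 inside the current
    segment; a cut removes one of them from both halves. *)
Lemma edge_induction (j : nat) (P : R -> R -> Prop) : (j < length E)%nat ->
  (forall a b, 0 <= a -> a < b -> b <= len j -> (forall s, a < s < b -> ~ In (PE j s) F) ->
     (forall e, e = a \/ e = b -> (exists v, edge_pt j e = PV v) \/ In (edge_pt j e) F) ->
     P a b) ->
  (forall a c b, a < c < b -> P a c -> P c b -> P a b) ->
  P 0 (len j).
Proof.
  intros Hj Hseg Hcat.
  assert (H : forall ts a b, 0 <= a -> a < b -> b <= len j ->
    (forall s, a < s < b -> In (PE j s) F -> In (PE j s) ts) ->
    (exists v, edge_pt j a = PV v) \/ In (edge_pt j a) F ->
    (exists v, edge_pt j b = PV v) \/ In (edge_pt j b) F -> P a b).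
  { induction ts as [|p ts IH]; intros a b Ha Hab Hb Hts Ea Eb.
    - apply Hseg; auto. intros e [->| ->]; auto.
    - destruct (classic (exists s, a < s < b /\ In (PE j s) F /\ PE j s = p))
        as [[s [Hs [HsF <-]]]|Hn].
      + assert (Es : In (edge_pt j s) F) by (rewrite edge_pt_in; auto; lra).
        apply (Hcat a s b Hs); apply IH; auto; try lra.
        * intros u Hu HuF. destruct (Hts u ltac:(lra) HuF) as [H|H]; [injection H; lra|easy].
        * intros u Hu HuF. destruct (Hts u ltac:(lra) HuF) as [H|H]; [injection H; lra|easy].
      + apply IH; auto. intros s Hs HsF.
        destruct (Hts s Hs HsF) as [H|H]; [|easy]. exfalso; eauto. }
  destruct (edge_bounds j Hj) as [_ [_ Hlen]].
  apply (H F); auto; try lra.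
  - left. exists (src j). apply edge_pt_0.
  - left. exists (dst j). now apply edge_pt_len.
Qed.

(** * The payoff as a function of one facility of P2 *)

(** With [edge_pt] in place of [PE] the integrand is meaningful at the ends of the edge too, and the
    integral is the same. *)
Definition served_int (S : list point) (j : nat) (t : R) : R :=
  ind (served E F S (edge_pt j t)) 1.

Lemma served_integrable (S : list point) (j : nat) :
  (forall p, In p S -> valid p) -> (j < length E)%nat ->
  ex_RInt (served_int S j) 0 (len j).
Proof.
  intros HS Hj. apply (edge_induction j (ex_RInt (served_int S j))); [easy| |].
  - intros a b Ha Hab Hb Hfree _. unfold served_int, served.
    apply (served_segment_integrable a b (fun t => D (edge_pt j t)) S
      (fun s t => gdist E (edge_pt j t) s)); [lra|now apply dist_set_segment|].
    intros s t u Hs Ht Hu. apply gdist_edge_pt_lip; auto; lra.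
  - intros a c b _. apply ex_RInt_Chasles.
Qed.

Lemma served_len_RInt (S : list point) (j : nat) :
  (forall p, In p S -> valid p) -> (j < length E)%nat ->
  served_len E F S j = RInt (served_int S j) 0 (len j).
Proof.
  intros HS Hj. assert (Hi := served_integrable S j HS Hj).
  destruct (edge_bounds j Hj) as [_ [_ Hlen]].
  assert (Heq : forall t, Rmin 0 (len j) < t < Rmax 0 (len j) ->
    served_int S j t = ind (served E F S (PE j t)) 1).
  { intros t. rewrite Rmin_left, Rmax_right by lra. intros Ht.
    unfold served_int. now rewrite edge_pt_in. }
  unfold served_len. rewrite integral_RInt.
  - symmetry. apply RInt_ext, Heq.
  - eapply ex_RInt_ext; [exact Heq|exact Hi].
Qed.

Lemma served_mono (S S' : list point) (p : point) :
  incl S S' -> served E F S p -> served E F S' p.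
Proof. intros H [s [Hs Hd]]. exists s; auto. Qed.

Lemma sumR_affine (X : R -> Prop) (x0 : R) {A} (l : list A) (h : R -> A -> R) :
  (forall y, In y l -> exists c, forall x, X x -> h x0 y + c * (x - x0) <= h x y) ->
  exists c, forall x, X x -> sumR (map (h x0) l) + c * (x - x0) <= sumR (map (h x) l).
Proof.
  induction l as [|y l IH]; intros H; [exists 0; intros; simpl; lra|].
  destruct IH as [c Hc]; [intros; apply H; now right|].
  destruct (H y (or_introl eq_refl)) as [c' Hc'].
  exists (c + c'). intros x Hx. specialize (Hc x Hx). specialize (Hc' x Hx).
  unfold sumR in *; simpl. lra.
Qed.

Lemma sumR_le {A} (l : list A) (g h : A -> R) :
  (forall y, In y l -> g y <= h y) -> sumR (map g l) <= sumR (map h l).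
Proof.
  intros H. induction l as [|y l IH]; [simpl; lra|].
  specialize (IH (fun z Hz => H z (or_intror Hz))). specialize (H y (or_introl eq_refl)).
  unfold sumR in *; simpl; lra.
Qed.

Lemma weight_nonneg (v : nat) : (v < n)%nat -> 0 <= wv v.
Proof. apply HG. Qed.

(** Since only inclusion matters, this also serves to permute lists and to drop repetitions. *)
Lemma Q2_mono (S S' : list point) : (forall p, In p S' -> valid p) -> incl S S' ->
  Q2 n E wv F S <= Q2 n E wv F S'.
Proof.
  intros HS' Hincl. unfold Q2.
  apply Rplus_le_compat; apply sumR_le; intros j Hj; apply in_seq in Hj.
  - apply ind_mono; [apply weight_nonneg; lia|now apply served_mono].
  - destruct (edge_bounds j ltac:(lia)) as [_ [_ Hlen]].
    rewrite !served_len_RInt; auto; try lia.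
    apply RInt_le; [lra|apply served_integrable; auto; lia|apply served_integrable; auto; lia|].
    intros t _. apply ind_mono; [lra|now apply served_mono].
Qed.

Lemma Q2_le (S : list point) : (forall p, In p S -> valid p) ->
  Q2 n E wv F S <= sumR (map wv (seq 0 n)) + sumR (map (fun j => len j) (seq 0 (length E))).
Proof.
  intros HS. unfold Q2.
  apply Rplus_le_compat; apply sumR_le; intros j Hj; apply in_seq in Hj.
  - unfold ind. destruct excluded_middle_informative; [lra|apply weight_nonneg; lia].
  - destruct (edge_bounds j ltac:(lia)) as [_ [_ Hlen]].
    rewrite served_len_RInt; auto; [|lia]. rewrite <- (Rminus_0_r (len j)) at 2.
    apply RInt_ind_le; try lra; [apply served_integrable; auto; lia|intros; lra].
Qed.

Section Move.

Context (i : nat) (a x0 b : R) (Hi : (i < length E)%nat) (Ha : 0 <= a) (Hax : a < x0)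
  (Hxb : x0 < b) (Hb : b <= len i)
  (Hfree : forall y, a < y < b -> ~ In (PE i y) F)
  (Hgamma : forall v y, (v < n)%nat -> a < y < b -> d (PV v) (PE i y) <> D (PV v)).

Let X (x : R) := a <= x <= b.

(** The distance is [Rmin (A + x) (B - x)] and avoids the value [c] strictly between [a] and [b]. By
    continuity it stays on the side of [c] where it is at [x0], up to equality at [a] and [b]. *)
Lemma vertex_status (v : nat) : (v < n)%nat ->
  (d (PV v) (edge_pt i x0) <= D (PV v) /\
   exists s, forall x, X x -> d (PV v) (edge_pt i x) <= D (PV v) /\
     d (PV v) (edge_pt i x) <= d (PV v) (edge_pt i x0) + s * (x - x0)) \/
  (D (PV v) < d (PV v) (edge_pt i x0) /\ forall x, X x -> D (PV v) <= d (PV v) (edge_pt i x)).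
Proof.
  intros Hv. unfold X. set (c := D (PV v)).
  set (A := d (PV v) (PV (src i))). set (B := d (PV v) (PV (dst i)) + len i).
  assert (Hd : forall x, a <= x <= b -> d (PV v) (edge_pt i x) = Rmin (A + x) (B - x)).
  { intros x Hx. rewrite gdist_to_edge_pt by (auto; lra). f_equal. unfold B; lra. }
  assert (Hc : forall y, a < y < b -> Rmin (A + y) (B - y) <> c).
  { intros y Hy. rewrite <- Hd by lra. rewrite edge_pt_in by lra. now apply Hgamma. }
  assert (Hmin : forall y z, y <= z -> Rmin y z = y) by (intros; now apply Rmin_left).
  assert (Hmin' : forall y z, z <= y -> Rmin y z = z) by (intros; now apply Rmin_right).
  rewrite (Hd x0) by lra.
  destruct (Rtotal_order (Rmin (A + x0) (B - x0)) c) as [Hlt|[Heq|Hgt]].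
  - left. split; [lra|].
    assert (Hle : forall x, a <= x <= b -> Rmin (A + x) (B - x) <= c).
    { intros x Hx. apply Rnot_lt_le. intros Hgt.
      assert (H1 := Rmin_l (A + x) (B - x)). assert (H2 := Rmin_r (A + x) (B - x)).
      (* A crossing would be explicit: the increasing branch has the value [c] at [c - A], the
         decreasing one at [B - c]. *)
      destruct (Rle_dec (A + x0) (B - x0)).
      - rewrite Hmin in Hlt by lra. apply (Hc (c - A)); [lra|]. rewrite Hmin; lra.
      - rewrite Hmin' in Hlt by lra. apply (Hc (B - c)); [lra|]. rewrite Hmin'; lra. }
    (* The branch that attains the minimum at [x0] is an affine majorant exact there. *)
    destruct (Rle_dec (A + x0) (B - x0)); [exists 1|exists (- 1)];
      intros x Hx; rewrite Hd by lra; (split; [auto|]).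
    + rewrite (Hmin (A + x0)) by lra. eapply Rle_trans; [apply Rmin_l|lra].
    + rewrite (Hmin' (A + x0)) by lra. eapply Rle_trans; [apply Rmin_r|lra].
  - now elim (Hc x0).
  - right. split; [lra|]. intros x Hx. rewrite Hd by lra.
    assert (H1 := Rmin_l (A + x0) (B - x0)). assert (H2 := Rmin_r (A + x0) (B - x0)).
    apply Rmin_glb; apply Rnot_lt_le; intros Hlt.
    + apply (Hc (c - A)); [lra|]. rewrite Hmin; lra.
    + apply (Hc (B - c)); [lra|]. rewrite Hmin'; lra.
Qed.

Section Segment.

Context (j : nat) (al be : R) (Hj : (j < length E)%nat) (Hal : 0 <= al) (Hab : al < be)
  (Hbe : be <= len j)
  (Hends : forall e, e = al \/ e = be -> (exists v, edge_pt j e = PV v) \/ In (edge_pt j e) F).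

Lemma fixed_site_ok (s : point) : valid s ->
  site_ok X x0 al be (fun t => D (edge_pt j t)) (fun _ t => d (edge_pt j t) s).
Proof.
  intros Hs. split.
  - intros x t _ Ht. apply gdist_nonneg; auto. apply edge_pt_valid; auto; lra.
  - intros x t u _ Ht Hu. apply gdist_edge_pt_lip; auto; lra.
  - exists (match s with PE _ tau => tau | PV _ => 0 end). intros t Ht.
    destruct (gdist_segment j al be t s) as [H|[H|[tau [Htau [-> H]]]]]; auto; try lra.
    right; right. split; [easy|]. exists 0. intros x _. rewrite Rmult_0_l, Rplus_0_r.
    split; [lra|]. intros u Hu. rewrite <- (edge_pt_in j tau) by lra.
    apply gdist_edge_pt_direct; auto; lra.
  - intros e He. destruct (Rle_dec (d (edge_pt j e) s) (D (edge_pt j e))); [left|right].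
    + split; [easy|]. exists 0. intros. lra.
    + split; [lra|]. intros. lra.
Qed.

Lemma moving_site_ok :
  site_ok X x0 al be (fun t => D (edge_pt j t)) (fun x t => d (edge_pt j t) (edge_pt i x)).
Proof.
  assert (HX : forall x, X x -> valid (edge_pt i x)).
  { intros x Hx. unfold X in Hx. apply edge_pt_valid; auto; lra. }
  assert (H0 : valid (edge_pt i x0)) by (apply HX; unfold X; lra).
  assert (HV : forall t, al <= t <= be -> valid (edge_pt j t))
    by (intros; apply edge_pt_valid; auto; lra).
  split.
  - intros x t Hx Ht. apply gdist_nonneg; auto.
  - intros x t u Hx Ht Hu. apply gdist_edge_pt_lip; auto; lra.
  - exists x0. intros t Ht.
    destruct (gdist_segment j al be t (edge_pt i x0)) as [H|[H|[tau [Htau [Htau' H]]]]];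
      auto; try lra.
    rewrite edge_pt_in in Htau' by lra. injection Htau' as <- <-.
    right; right. split; [easy|]. exists 1. intros x Hx. unfold X in Hx.
    replace (x0 + 1 * (x - x0)) with x by ring.
    (* A segment end strictly between [a] and [b] would be a facility of P1, which [Hfree] excludes.
       So a segment that contains [x0] contains all of [[a, b]], and the facility does not leave
       it. *)
    assert (Hout : forall e, e = al \/ e = be -> ~ a < e < b).
    { intros e He Hae.
      destruct (Hends e He) as [[v Hv]|Hv].
      - rewrite edge_pt_in in Hv; [easy|lra].
      - rewrite edge_pt_in in Hv by lra. now apply (Hfree e). }
    assert (Hal' := Hout al (or_introl eq_refl)). assert (Hbe' := Hout be (or_intror eq_refl)).
    assert (al <= a) by (apply Rnot_lt_le; intros ?; apply Hal'; lra).
    assert (b <= be) by (apply Rnot_lt_le; intros ?; apply Hbe'; lra).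
    split; [lra|]. intros u Hu. apply gdist_edge_pt_direct; auto; lra.
  - intros e He. assert (He' : al <= e <= be) by (destruct He; lra).
    assert (Hv := HV e He').
    destruct (Hends e He) as [[v Ev]|HeF].
    + rewrite Ev in *. now apply vertex_status.
    (* At a facility of P1 [D] is 0, so P1 is at least as close for every [x], and strictly closer
       at [x0]. *)
    + right. rewrite dist_set_edge_pt_in by (auto; lra). split.
      * rewrite (edge_pt_in i x0) by lra. apply edge_pt_gdist_pos; auto; try lra.
        -- rewrite edge_pt_in in H0 by lra. easy.
        -- intros Heq. rewrite Heq in HeF. apply (Hfree x0); auto.
      * intros x Hx. apply gdist_nonneg; auto.
Qed.

End Segment.

Context (S : list point) (HS : forall p, In p S -> valid p).

Lemma moved_valid (x : R) (p : point) : X x -> In p (edge_pt i x :: S) -> valid p.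
Proof.
  unfold X. intros Hx [<-|Hp]; auto. apply edge_pt_valid; auto; lra.
Qed.

Lemma served_len_affine_minorant (j : nat) : (j < length E)%nat ->
  exists c, forall x, X x ->
    served_len E F (edge_pt i x0 :: S) j + c * (x - x0) <= served_len E F (edge_pt i x :: S) j.
Proof.
  intros Hj.
  assert (H0 : X x0) by (unfold X; lra).
  (* Integrability is carried along because [RInt_Chasles] asks for it on both pieces. *)
  assert (H : (forall x, X x -> ex_RInt (served_int (edge_pt i x :: S) j) 0 (len j)) /\
    exists c, forall x, X x -> RInt (served_int (edge_pt i x0 :: S) j) 0 (len j) + c * (x - x0) <=
                        RInt (served_int (edge_pt i x :: S) j) 0 (len j)).
  { apply (edge_induction j (fun al be =>
      (forall x, X x -> ex_RInt (served_int (edge_pt i x :: S) j) al be) /\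
      exists c, forall x, X x -> RInt (served_int (edge_pt i x0 :: S) j) al be + c * (x - x0) <=
                          RInt (served_int (edge_pt i x :: S) j) al be)); [easy| |].
    - intros al be Hal Hab Hbe Hf Hends. split.
      + intros x Hx. unfold served_int, served.
        apply (served_segment_integrable al be (fun t => D (edge_pt j t)) (edge_pt i x :: S)
          (fun s t => gdist E (edge_pt j t) s)); [lra|now apply dist_set_segment|].
        intros s t u Hs Ht Hu. apply gdist_edge_pt_lip; auto; try lra. eapply moved_valid; eauto.
      + set (sites := (fun x t => d (edge_pt j t) (edge_pt i x)) ::
                      map (fun s _ t => d (edge_pt j t) s) S : list (R -> R -> R)).
        destruct (served_segment_affine_minorant X x0 al be (fun t => D (edge_pt j t)) sites)
          as [c Hc]; [lra|easy|now apply dist_set_segment| |].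
        { intros f [<-|Hf']; [now apply moving_site_ok|].
          apply in_map_iff in Hf'. destruct Hf' as [s [<- Hs]]. apply fixed_site_ok; auto. }
        assert (Heq : forall x, RInt (served_int (edge_pt i x :: S) j) al be =
          RInt (fun t => ind (exists f, In f sites /\ f x t <= D (edge_pt j t)) 1) al be).
        { intros x. apply RInt_ext. intros t _. unfold served_int, served.
          apply Rle_antisym; apply ind_mono; try lra.
          - intros [s [[<-|Hs] Hd]].
            + eexists; split; [left; reflexivity|exact Hd].
            + exists (fun _ t => d (edge_pt j t) s); split; [right|exact Hd].
              apply (in_map (fun s _ t => d (edge_pt j t) s)), Hs.
          - intros [f [[<-|Hs] Hd]].
            + eexists; split; [left; reflexivity|exact Hd].
            + apply in_map_iff in Hs. destruct Hs as [s [<- Hs]].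
              exists s; split; [now right|exact Hd]. }
        exists c. intros x Hx. rewrite !Heq. now apply Hc.
    - intros al m be Hm [I1 [c1 H1]] [I2 [c2 H2]]. split.
      + intros x Hx. eapply ex_RInt_Chasles; eauto.
      + exists (c1 + c2). intros x Hx.
        rewrite <- (RInt_Chasles _ al m be (I1 x0 H0) (I2 x0 H0)).
        rewrite <- (RInt_Chasles _ al m be (I1 x Hx) (I2 x Hx)).
        specialize (H1 x Hx). specialize (H2 x Hx). unfold plus; simpl. lra. }
  destruct H as [_ [c Hc]]. exists c. intros x Hx.
  rewrite !served_len_RInt; auto; intros p; now apply moved_valid.
Qed.

Lemma Q2_affine_minorant : exists c, forall x, X x ->
  Q2 n E wv F (edge_pt i x0 :: S) + c * (x - x0) <= Q2 n E wv F (edge_pt i x :: S).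
Proof.
  destruct (sumR_affine X x0 (seq 0 n)
    (fun x v => ind (served E F (edge_pt i x :: S) (PV v)) (wv v))) as [c Hc].
  (* Slope 0 is enough for vertices: one served at [x0] stays served on all of [[a, b]]. *)
  - intros v Hv. apply in_seq in Hv. exists 0. intros x Hx.
    rewrite Rmult_0_l, Rplus_0_r. apply ind_mono; [apply weight_nonneg; lia|].
    intros [s [[<-|Hs] Hd]].
    + exists (edge_pt i x); split; [now left|].
      destruct (vertex_status v ltac:(lia)) as [[_ [s H]]|[H _]]; [now apply H|lra].
    + exists s; split; [now right|easy].
  - destruct (sumR_affine X x0 (seq 0 (length E))
      (fun x => served_len E F (edge_pt i x :: S))) as [c' Hc'].
    + intros j Hj. apply in_seq in Hj. apply served_len_affine_minorant. lia.
    + exists (c + c'). intros x Hx. specialize (Hc x Hx). specialize (Hc' x Hx).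
      unfold Q2. lra.
Qed.

End Move.

Context (f : nat -> point)
  (Hf : forall v, (v < n)%nat -> In (f v) F /\ d (PV v) (f v) = D (PV v)).

(** * Candidates *)

Definition gamma0 (p : point) : Prop :=
  exists v, (v < n)%nat /\ p <> f v /\ d (PV v) p = D (PV v).

Definition candidate (eps : R) (p : point) : Prop :=
  valid p /\ (gamma0 p \/ (exists v, p = PV v) \/ D p = eps) /\ ~ In p F.

Lemma finite_valid_PV : finite (fun p => valid p /\ exists v, p = PV v).
Proof.
  exists (map PV (seq 0 n)). intros p [Hp [v ->]]. apply in_map, in_seq. simpl in Hp. lia.
Qed.

(** On an edge, each of the two affine branches of the distance from [v] takes the value [D (PV v)]
    at one coordinate only. *)
Lemma finite_gamma0 : finite (fun p => valid p /\ gamma0 p).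
Proof.
  apply finite_sub with (fun p => (valid p /\ exists v, p = PV v) \/
    exists v, In v (seq 0 n) /\ exists i, In i (seq 0 (length E)) /\
      (p = PE i (D (PV v) - d (PV v) (PV (src i))) \/
       p = PE i (d (PV v) (PV (dst i)) + len i - D (PV v)))).
  - intros [u|i t] [Hp [v [Hv [_ Hd]]]]; [left; eauto|right].
    exists v; split; [apply in_seq; lia|]. exists i; split; [apply in_seq; simpl in Hp; lia|].
    rewrite gdist_VE in Hd by auto. unfold Rmin in Hd.
    destruct Rle_dec; [left|right]; f_equal; lra.
  - apply finite_or; [apply finite_valid_PV|].
    do 2 (apply finite_ex; intros ? _). apply finite_or; apply finite_single.
Qed.

Lemma finite_candidate (eps : R) : finite (candidate eps).
Proof.
  (* The coordinates solve the equation that a route to [q] has length [eps], for the routes through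
     the source, through the target, and along the edge from either side. The default 0 for a vertex
     [q] only enlarges the list. *)
  apply finite_sub with (fun p => (valid p /\ gamma0 p) \/ (valid p /\ exists v, p = PV v) \/
    exists q, In q F /\ exists i, In i (seq 0 (length E)) /\
      (p = PE i (eps - d (PV (src i)) q) \/ p = PE i (len i + d (PV (dst i)) q - eps) \/
       p = PE i (match q with PE _ s => s + eps | PV _ => 0 end) \/
       p = PE i (match q with PE _ s => s - eps | PV _ => 0 end))).
  - intros p [Hp [[Hg|[Hv|Hd]] _]]; auto.
    destruct p as [v|i t]; [right; left; split; eauto|right; right].
    destruct (dist_set_attained E (PE i t) F HF0) as [q [Hq Hdq]].
    exists q; split; [easy|]. exists i; split; [apply in_seq; simpl in Hp; lia|].
    destruct (gdist_PE_cases i t q Hp (HF q Hq)) as [H|[H|[s [-> H]]]];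
      [left; f_equal; lra|right; left; f_equal; lra|right; right].
    unfold Rabs in H. destruct Rcase_abs; [right|left]; f_equal; lra.
  - apply finite_or; [apply finite_gamma0|apply finite_or; [apply finite_valid_PV|]].
    do 2 (apply finite_ex; intros ? _). repeat apply finite_or; apply finite_single.
Qed.

Lemma breakpoints_finite (i : nat) : (i < length E)%nat ->
  finite (fun y => 0 <= y <= len i /\
    (y = 0 \/ y = len i \/ gamma0 (edge_pt i y) \/ In (edge_pt i y) F)).
Proof.
  intros Hi. destruct finite_gamma0 as [l Hl].
  apply finite_sub with (fun y => y = 0 \/ y = len i \/ exists p, In p (l ++ F) /\
    y = match p with PE _ t => t | PV _ => 0 end).
  - intros y [Hy Hb].
    destruct (Req_dec_T y 0); [now left|]. destruct (Req_dec_T y (len i)); [now right; left|].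
    right; right. exists (PE i y); split; [|easy].
    rewrite edge_pt_in in Hb by lra. apply in_or_app.
    destruct Hb as [Hb|[Hb|[Hb|Hb]]]; try easy; [left|now right].
    apply Hl. split; [|easy]. split; [easy|lra].
  - apply finite_or; [apply finite_single|apply finite_or; [apply finite_single|]].
    apply finite_ex; intros p _; apply finite_single.
Qed.

Lemma move_to_candidate (s : point) : valid s -> ~ In s F ->
  exists e0, 0 < e0 /\ forall eps, 0 < eps <= e0 ->
    forall S, (forall p, In p S -> valid p) ->
    exists s', candidate eps s' /\ Q2 n E wv F (s :: S) <= Q2 n E wv F (s' :: S).
Proof.
  intros Hs HsF.
  destruct (classic (gamma0 s \/ exists v, s = PV v)) as [Hc|Hc].
  { exists 1. split; [lra|]. intros eps _ S _. exists s; split; [|lra].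
    split; [easy|]. split; [|easy]. destruct Hc; auto. }
  destruct s as [v|i x0]; [exfalso; eauto|].
  assert (Hi : (i < length E)%nat) by apply Hs.
  assert (Hx0 : 0 < x0 < len i) by apply Hs.
  set (bp := fun y => 0 <= y <= len i /\
    (y = 0 \/ y = len i \/ gamma0 (edge_pt i y) \/ In (edge_pt i y) F)).
  destruct (finite_argmax (fun y => y) (fun y => bp y /\ y < x0)) as [a [[Ba Hax] Hamax]].
  { eapply finite_sub; [|apply (breakpoints_finite i Hi)]. now intros y [H _]. }
  { exists 0. split; [|lra]. split; [lra|now left]. }
  destruct (finite_argmax Ropp (fun y => bp y /\ x0 < y)) as [b [[Bb Hxb] Hbmin]].
  { eapply finite_sub; [|apply (breakpoints_finite i Hi)]. now intros y [H _]. }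
  { exists (len i). split; [|lra]. split; [lra|now right; left]. }
  assert (Hnb : forall y, a < y < b -> ~ bp y).
  { intros y Hy By. destruct (Rtotal_order y x0) as [H|[->|H]].
    - specialize (Hamax y (conj By H)). lra.
    - destruct By as [_ By]. rewrite edge_pt_in in By by lra.
      destruct By as [By|[By|[By|By]]]; try lra; [apply Hc; now left|easy].
    - specialize (Hbmin y (conj By H)). lra. }
  assert (Ha0 : 0 <= a) by apply Ba. assert (Hbl : b <= len i) by apply Bb.
  assert (Hfree : forall y, a < y < b -> ~ In (PE i y) F).
  { intros y Hy HyF. apply (Hnb y Hy). split; [lra|]. rewrite edge_pt_in by lra. auto. }
  assert (Hgamma : forall v y, (v < n)%nat -> a < y < b -> d (PV v) (PE i y) <> D (PV v)).
  { intros v y Hv Hy Hd. apply (Hnb y Hy). split; [lra|]. rewrite edge_pt_in by lra.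
    right; right; left. exists v; repeat split; auto.
    (* [gamma0] leaves out [f v], but that point is in [F] and hence not inside the interval. *)
    intros Heq. apply (Hfree y Hy). rewrite Heq. now apply Hf. }
  assert (HD := dist_set_segment i a b Hi Ha0 ltac:(lra) Hbl Hfree).
  assert (Hend : forall eps y, bp y -> ~ In (edge_pt i y) F ->
    candidate eps (edge_pt i y)).
  { intros eps y [Hy By] HyF. split; [now apply edge_pt_valid|]. split; [|easy].
    destruct By as [->|[->|[By|By]]]; [| |now left|easy].
    - right; left. exists (src i). apply edge_pt_0.
    - right; left. exists (dst i). now apply edge_pt_len. }
  assert (Hnear : forall eps y, a < y < b -> D (edge_pt i y) = eps -> candidate eps (edge_pt i y)).
  { intros eps y Hy Hd. split; [apply edge_pt_valid; auto; lra|]. split; [now right; right|].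
    rewrite edge_pt_in by lra. auto. }
  (* Keeps [b - eps] at or right of [x0] and [a + eps] at or left of it. Each is then at least [eps]
     away from the opposite end, so its distance to [F] is exactly [eps] even if P1 holds both
     ends. *)
  exists (Rmin (x0 - a) (b - x0)). split; [apply Rmin_glb_lt; lra|].
  intros eps Heps S HS.
  assert (He1 := Rmin_l (x0 - a) (b - x0)). assert (He2 := Rmin_r (x0 - a) (b - x0)).
  destruct (Q2_affine_minorant i a x0 b Hi Ha0 Hax Hxb Hbl Hfree Hgamma S HS) as [c Hc'].
  rewrite (edge_pt_in i x0) in Hc' by lra.
  assert (Hmove : forall x, a <= x <= b -> 0 <= c * (x - x0) -> candidate eps (edge_pt i x) ->
    exists s', candidate eps s' /\ Q2 n E wv F (PE i x0 :: S) <= Q2 n E wv F (s' :: S)).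
  { intros x Hx Hcx Hcand. exists (edge_pt i x); split; [easy|]. specialize (Hc' x Hx). lra. }
  destruct (Rle_dec 0 c) as [Hpos|Hneg].
  - destruct (classic (In (edge_pt i b) F)) as [HbF|HbF].
    + apply (Hmove (b - eps)); [lra|apply Rmult_le_pos; lra|]. apply Hnear; [lra|].
      assert (H0 : D (edge_pt i b) = 0) by (apply dist_set_edge_pt_in; auto; lra).
      assert (H1 := seg_right _ _ _ HD (b - eps) ltac:(lra)).
      assert (H2 := seg_nonneg _ _ _ HD). simpl in *.
      destruct (seg_cases _ _ _ HD (b - eps) ltac:(lra)) as [H|H]; simpl in *; lra.
    + apply (Hmove b); [lra|apply Rmult_le_pos; lra|]. now apply Hend.
  - assert (Hle : forall x, x <= x0 -> 0 <= c * (x - x0)).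
    { intros x Hx. replace (c * (x - x0)) with ((- c) * (x0 - x)) by ring.
      apply Rmult_le_pos; lra. }
    destruct (classic (In (edge_pt i a) F)) as [HaF|HaF].
    + apply (Hmove (a + eps)); [lra|apply Hle; lra|]. apply Hnear; [lra|].
      assert (H0 : D (edge_pt i a) = 0) by (apply dist_set_edge_pt_in; auto; lra).
      assert (H1 := seg_left _ _ _ HD (a + eps) ltac:(lra)).
      assert (H2 := seg_nonneg _ _ _ HD). simpl in *.
      destruct (seg_cases _ _ _ HD (a + eps) ltac:(lra)) as [H|H]; simpl in *; lra.
    + apply (Hmove a); [lra|apply Hle; lra|]. now apply Hend.
Qed.

(** [T] is arbitrary so that it can take up the facilities already moved: after [s] has become [s'],
    the induction hypothesis is applied with [s' :: T]. *)
Lemma move_all_to_candidates (S : list point) :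
  (forall p, In p S -> valid p) -> (forall p, In p S -> ~ In p F) ->
  exists e0, 0 < e0 /\ forall eps, 0 < eps <= e0 ->
    forall T, (forall p, In p T -> valid p) ->
    exists S', length S' = length S /\ (forall p, In p S' -> candidate eps p) /\
      Q2 n E wv F (S ++ T) <= Q2 n E wv F (S' ++ T).
Proof.
  induction S as [|s S IH]; intros HS HSF.
  - exists 1. split; [lra|]. intros eps _ T _. exists []. split; [easy|]. split; [easy|lra].
  - destruct IH as [e1 [He1 H1]]; [intros; apply HS; now right|intros; apply HSF; now right|].
    destruct (move_to_candidate s) as [e2 [He2 H2]]; [apply HS; now left|apply HSF; now left|].
    exists (Rmin e1 e2). split; [now apply Rmin_glb_lt|]. intros eps Heps T HT.
    assert (Hm1 := Rmin_l e1 e2). assert (Hm2 := Rmin_r e1 e2).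
    destruct (H2 eps ltac:(lra) (S ++ T)) as [s' [Hs' HQ1]].
    { intros p Hp. apply in_app_or in Hp. destruct Hp; auto. apply HS; now right. }
    destruct (H1 eps ltac:(lra) (s' :: T)) as [S' [HL [HS' HQ2]]].
    { intros p [<-|Hp]; auto. apply Hs'. }
    exists (s' :: S'). split; [simpl; now rewrite HL|]. split.
    + intros p [<-|Hp]; auto.
    + simpl. eapply Rle_trans; [exact HQ1|].
      (* The lists on both sides of [HQ2] have [s'] in the middle; inclusion moves it there and back
         to the front. *)
      eapply Rle_trans; [|eapply Rle_trans; [exact HQ2|]]; apply Q2_mono.
      * intros p Hp. apply in_app_or in Hp. destruct Hp as [Hp|[<-|Hp]]; auto; [|apply Hs'].
        apply HS; now right.
      * intros p [<-|Hp]; apply in_or_app; [right; now left|].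
        apply in_app_or in Hp. destruct Hp; [now left|right; now right].
      * intros p [<-|Hp]; [apply Hs'|]. apply in_app_or in Hp. destruct Hp as [Hp|Hp]; auto.
        now apply HS'.
      * intros p Hp. apply in_app_or in Hp. destruct Hp as [Hp|[<-|Hp]];
          [right; apply in_or_app; now left|now left|right; apply in_or_app; now right].
Qed.

(** A restricted placement has at most [k] points while P2 has to place exactly [k]; the missing
    ones can be added without lowering the payoff. *)
Lemma extend_points (k : nat) (S : list point) : NoDup S -> (length S <= k)%nat ->
  (forall p, In p S -> valid p /\ ~ In p F) ->
  exists S', incl S S' /\ NoDup S' /\ length S' = k /\ forall p, In p S' -> valid p /\ ~ In p F.
Proof.
  intros HN HL HS. replace k with (length S + (k - length S))%nat by lia.
  generalize (k - length S)%nat as r. clear HL k. intros r.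
  induction r as [|r (S' & Hi & HN' & HL & HS')].
  - exists S. repeat split; auto; try apply HS; auto; [apply incl_refl|lia].
  - destruct (fresh_point (S' ++ F)) as [p [Hp Hn]].
    exists (p :: S'). split; [now apply incl_tl|]. split; [|split; [simpl; lia|]].
    + constructor; [|easy]. intros H. apply Hn, in_or_app. now left.
    + intros q [<-|Hq]; auto. split; [easy|]. intros H. apply Hn, in_or_app. now right.
Qed.

End Graph.

Theorem theorem2 (n : nat) (E : list edge) (wv : nat -> R) (F : list point)
  (m k : nat) (f : nat -> point) :
  good_graph n E wv ->
  (1 <= m)%nat -> point_set n E F -> length F = m ->
  (forall v, (v < n)%nat -> In (f v) F /\ gdist E (PV v) (f v) = dist_set E (PV v) F) ->
  let Gamma0 := fun p => exists v, (v < n)%nat /\ p <> f v /\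
                          gdist E (PV v) p = dist_set E (PV v) F in
  let C := fun (eps : R) (p : point) =>
     valid_point n E p /\ (Gamma0 p \/ (exists v, p = PV v) \/ dist_set E p F = eps)
     /\ ~ In p F in
  let admissible := fun S => point_set n E S /\ length S = k /\
                             (forall p, In p S -> ~ In p F) in
  let restricted := fun eps S => point_set n E S /\ (length S <= k)%nat /\
                             (forall p, In p S -> C eps p) in
  (forall eps, 0 < eps -> exists S, restricted eps S /\
       forall S', restricted eps S' -> Q2 n E wv F S' <= Q2 n E wv F S) /\
  exists eta,
    is_lub (fun r => exists S, admissible S /\ r = Q2 n E wv F S) eta /\
    is_lub (fun r => exists eps S, 0 < eps /\ restricted eps S /\ r = Q2 n E wv F S) eta.
Proof.
  intros HG Hm [HFN HF] HFm Hf Gamma0 C admissible restricted.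
  assert (HF0 : F <> []) by (intros ->; simpl in HFm; lia).
  assert (HC : forall eps p, C eps p -> valid_point n E p /\ ~ In p F)
    by (intros eps p [? [_ ?]]; auto).
  assert (Hext : forall eps S, restricted eps S ->
    exists S', admissible S' /\ Q2 n E wv F S <= Q2 n E wv F S').
  { intros eps S [[HN HV] [HL HCS]].
    destruct (extend_points n E wv HG F k S HN HL) as (S' & Hi & HN' & HL' & HS').
    - intros p Hp. eapply HC; eauto.
    - exists S'. split; [repeat split; auto; now apply HS'|].
      apply (Q2_mono n E wv HG F HF HF0); auto. now apply HS'. }
  assert (Hnil : forall eps, restricted eps [])
    by (intros eps; split; [split; [apply NoDup_nil|easy]|split; [apply Nat.le_0_l|easy]]).
  split.
  - intros eps _. apply (finite_argmax (Q2 n E wv F) (restricted eps)).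
    + destruct (finite_candidate n E wv HG F HF HF0 f eps) as [l Hl].
      eapply finite_sub; [|apply (finite_lists l k)].
      intros S [_ [HL HCS]]. split; [easy|]. intros p Hp. apply Hl, HCS, Hp.
    + now exists [].
  - destruct (completeness (fun r => exists S, admissible S /\ r = Q2 n E wv F S)) as [eta Heta].
    + exists (sumR (map wv (seq 0 n)) +
        sumR (map (fun j => e_len (nth_edge E j)) (seq 0 (length E)))).
      intros r [S [[[_ HV] _] ->]]. apply (Q2_le n E wv HG F HF HF0 S HV).
    (* The supremum is over a nonempty set: even the empty placement extends to an admissible
       one. *)
    + destruct (Hext 1 [] (Hnil 1)) as [S [HS _]]. eauto.
    + exists eta. split; [easy|]. destruct Heta as [Hub Hlub]. split.
      * intros r (eps & S & Heps & HS & ->). destruct (Hext eps S HS) as [S' [HS' HQ]].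
        eapply Rle_trans; [exact HQ|]. apply Hub. eauto.
      * intros M HM. apply Hlub. intros r [S [[[HN HV] [HL HSF]] ->]].
        destruct (move_all_to_candidates n E wv HG F HF HF0 f Hf S HV HSF) as [e0 [He0 H]].
        destruct (H e0 ltac:(lra) []) as [S' [HL' [HS' HQ]]]; [easy|].
        rewrite !app_nil_r in HQ. eapply Rle_trans; [exact HQ|].
        (* Facilities may have been moved onto the same point; removing repetitions keeps the set of
           points and hence the payoff. *)
        pose (dec := fun p q : point => excluded_middle_informative (p = q)).
        assert (HV' : forall p, In p (nodup dec S') -> valid_point n E p)
          by (intros p Hp; apply nodup_In, HS' in Hp; apply Hp).
        eapply Rle_trans; [apply (Q2_mono n E wv HG F HF HF0 S' (nodup dec S')); [exact HV'|]|].
        -- intros p Hp. now apply nodup_In.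
        -- apply HM. exists e0, (nodup dec S'). split; [easy|]. split; [|easy].
           split; [split; [apply NoDup_nodup|exact HV']|]. split.
           ++ rewrite <- HL, <- HL'. apply NoDup_incl_length; [apply NoDup_nodup|].
              intros p Hp. now apply nodup_In in Hp.
           ++ intros p Hp. apply nodup_In in Hp. now apply HS'.
Qed.
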